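(* If $X$ is a path-connected Hausdorff space with basepoint $e$, then the inclusion of generators $\sigma:X\to J(X)$ induces a surjection $\sigma_\#:\pi_1(X,e)\to\pi_1(J(X),e)$.
   Context: The James reduced product of a based space $(X,e)$ is $J(X)=\coprod_{n\in\mathbb{N}}X^n/\sim$ where $\sim$ is generated by $(x_1,\dots,x_{j-1},e,x_{j+1},\dots,x_n)\sim(x_1,\dots,x_{j-1},x_{j+1},\dots,x_n)$; elements are finite words in $X\setminus\{e\}$ (the empty word is identified with $e$), and the monoid operation is word concatenation. Topology: $X^n$ has the product topology, $J_n(X)$ (words of length $\leq n$) has the quotient topology from $q_n:X^n\to J_n(X)$, and $J(X)$ has the weak topology with respect to $\{J_n(X)\}$ (a set is closed iff its intersection with each $J_n(X)$ is closed). $\sigma:X\to J(X)$ sends $x$ to the one-letter word $x$. *)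

(* Defs.v *)
From Stdlib Require Import Reals List Classical ClassicalEpsilon Arith Lia.
Open Scope R_scope.

Definition is_topology {T : Type} (O : (T -> Prop) -> Prop) : Prop :=
  O (fun _ => True) /\
  (forall U V, O U -> O V -> O (fun x => U x /\ V x)) /\
  (forall F : (T -> Prop) -> Prop, (forall U, F U -> O U) ->
     O (fun x => exists U, F U /\ U x)).

Definition continuous {A B : Type} (OA : (A -> Prop) -> Prop)
  (OB : (B -> Prop) -> Prop) (f : A -> B) : Prop :=
  forall V, OB V -> OA (fun x => V (f x)).

Definition hausdorff {T : Type} (O : (T -> Prop) -> Prop) : Prop :=
  forall x y : T, x <> y -> exists U V, O U /\ O V /\ U x /\ V y /\
    (forall z, ~ (U z /\ V z)).

Definition I : Type := {t : R | 0 <= t <= 1}.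
Definition I0 : I := exist _ 0 (conj (Rle_refl 0) Rle_0_1).
Definition I1 : I := exist _ 1 (conj Rle_0_1 (Rle_refl 1)).

Definition I_open (U : I -> Prop) : Prop :=
  forall t, U t -> exists eps, 0 < eps /\
    forall s : I, Rabs (proj1_sig s - proj1_sig t) < eps -> U s.

Definition II_open (U : I * I -> Prop) : Prop :=
  forall p, U p -> exists eps, 0 < eps /\
    forall q : I * I,
      Rabs (proj1_sig (fst q) - proj1_sig (fst p)) < eps ->
      Rabs (proj1_sig (snd q) - proj1_sig (snd p)) < eps -> U q.

Definition path_connected {T : Type} (O : (T -> Prop) -> Prop) : Prop :=
  forall x y : T, exists p : I -> T, continuous I_open O p /\ p I0 = x /\ p I1 = y.

Definition loop {T : Type} (O : (T -> Prop) -> Prop) (x0 : T) (g : I -> T) : Prop :=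
  continuous I_open O g /\ g I0 = x0 /\ g I1 = x0.

Definition homotopic_rel {T : Type} (O : (T -> Prop) -> Prop) (x0 : T)
  (g0 g1 : I -> T) : Prop :=
  exists H : I * I -> T, continuous II_open O H /\
    (forall s, H (s, I0) = g0 s) /\ (forall s, H (s, I1) = g1 s) /\
    (forall t, H (I0, t) = x0 /\ H (I1, t) = x0).

(** Elements of J(X): finite words in X \ {e}. *)
Definition word (X : Type) (e : X) : Type := {l : list X | Forall (fun x => x <> e) l}.

Fixpoint strip {X : Type} (e : X) (l : list X) : list X :=
  match l with
  | nil => nil
  | x :: l' => if excluded_middle_informative (x = e) then strip e l'
               else x :: strip e l'
  end.

Lemma strip_ok {X : Type} (e : X) (l : list X) : Forall (fun x => x <> e) (strip e l).
Proof.
  induction l as [|x l IH]; simpl; [constructor|].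
  destruct (excluded_middle_informative (x = e)); auto.
Qed.

Lemma strip_len {X : Type} (e : X) (l : list X) : (length (strip e l) <= length l)%nat.
Proof.
  induction l as [|x l IH]; simpl; [auto|].
  destruct (excluded_middle_informative (x = e)); simpl; lia.
Qed.

Definition Xpow (X : Type) (n : nat) : Type := {l : list X | length l = n}.

Definition prod_open (X : Type) (O : (X -> Prop) -> Prop) (n : nat)
  (U : Xpow X n -> Prop) : Prop :=
  forall x, U x -> exists Us : list (X -> Prop),
    Forall O Us /\ Forall2 (fun u a => u a) Us (proj1_sig x) /\
    (forall y : Xpow X n, Forall2 (fun u a => u a) Us (proj1_sig y) -> U y).

Definition Jn (X : Type) (e : X) (n : nat) : Type :=
  {w : word X e | (length (proj1_sig w) <= n)%nat}.

Definition qn (X : Type) (e : X) (n : nat) (x : Xpow X n) : Jn X e n :=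
  exist (fun w : word X e => (length (proj1_sig w) <= n)%nat)
    (exist _ (strip e (proj1_sig x)) (strip_ok e (proj1_sig x)))
    (Nat.le_trans _ _ _ (strip_len e (proj1_sig x)) (Nat.eq_le_incl _ _ (proj2_sig x))).

Definition Jn_open (X : Type) (O : (X -> Prop) -> Prop) (e : X) (n : nat)
  (V : Jn X e n -> Prop) : Prop :=
  prod_open X O n (fun x => V (qn X e n x)).

Definition Jn_closed (X : Type) (O : (X -> Prop) -> Prop) (e : X) (n : nat)
  (C : Jn X e n -> Prop) : Prop :=
  Jn_open X O e n (fun w => ~ C w).

Definition J_closed (X : Type) (O : (X -> Prop) -> Prop) (e : X)
  (C : word X e -> Prop) : Prop :=
  forall n, Jn_closed X O e n (fun w => C (proj1_sig w)).

Definition J_open (X : Type) (O : (X -> Prop) -> Prop) (e : X)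
  (U : word X e -> Prop) : Prop :=
  J_closed X O e (fun w => ~ U w).

(** Basepoint of J(X): the empty word (identified with e). *)
Definition J_unit (X : Type) (e : X) : word X e := exist _ nil (Forall_nil _).

Definition sigmaJ (X : Type) (e : X) (x : X) : word X e :=
  match excluded_middle_informative (x = e) with
  | left _ => J_unit X e
  | right h => exist _ (x :: nil) (Forall_cons x h (Forall_nil _))
  end.

(* Main.v *)
Require Import Defs.
From Stdlib Require Import Reals ZArith List Lra Lia.
From Stdlib Require Import Classical ClassicalEpsilon ProofIrrelevance Arith Cantor.
Import ListNotations.

(* A loop in J(X) is an infinite shuffle of loops in X. Near a time t0 each letter of the word at t0 moves
   continuously, and all other letters are close to e; so letters can be followed through time, each one
   living on an open interval and tending to e at both ends. There are countably many of them, and only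
   finitely many leave a given neighbourhood of e. Slow time down so that every letter c gets its own rest
   interval K_c, during which the clock stands still at a moment of its life, the K_c being pairwise
   disjoint. Now delay the letters individually until each one performs its whole life inside K_c. During
   this deformation a letter is present only at times when it was present before, so no new pair of letters
   meets, their order stays well defined and word lengths stay locally bounded; at the end at most one letter
   is present at a time, which is a loop in X. *)

(** Nothing is assumed about small neighbourhoods of [e]: a letter close to [e] need not be
    contractible there, so a subdivision of the loop cannot in general discard all but finitely many
    letters. Each one, however small, has to be kept for its whole life. Hausdorffness enters twice.
    It separates the letters of a word from [e], so that they can be recognised in nearby words by
    their rank among the letters outside a neighbourhood of [e]; and it keeps words of unbounded
    length from converging. That the clock rests at a moment of the life of [c] is what makes the
    delay harmless: it forces the clock to lie between this moment and the own time of [c], and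
    lifetimes are intervals. *)

(** * Words with inserted letters *)

Section Words.
Context {X : Type}.
Implicit Types (V U : X -> Prop) (Us : list (X -> Prop)) (l : list X) (a d : X).

(** The shape of a neighbourhood in J(X): a nearby word consists of the old letters, each moved a
    little within [Us], and of any number of new ones born in a neighbourhood [V] of [e]. *)
Inductive interleaved V : list (X -> Prop) -> list X -> Prop :=
| interleaved_nil : interleaved V nil nil
| interleaved_skip : forall Us a l,
    V a -> interleaved V Us l -> interleaved V Us (a :: l)
| interleaved_take : forall U Us a l,
    U a -> interleaved V Us l -> interleaved V (U :: Us) (a :: l).

(* [nth_outside V l j i]: the [j]-th letter of [l] outside [V] stands at position [i]. *)
Inductive nth_outside V : list X -> nat -> nat -> Prop :=
| nth_outside_here : forall a l, ~ V a -> nth_outside V (a :: l) 0 0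
| nth_outside_out : forall a l j i,
    ~ V a -> nth_outside V l j i -> nth_outside V (a :: l) (S j) (S i)
| nth_outside_in : forall a l j i,
    V a -> nth_outside V l j i -> nth_outside V (a :: l) j (S i).

Lemma nth_outside_lt V l j i : nth_outside V l j i -> (i < length l)%nat.
Proof. induction 1; simpl; lia. Qed.

(** [j] counts the letters outside [V] that stand before position [i]. Uniqueness of positions and
    the preservation of the order of letters both come from this. *)
Lemma nth_outside_mono V l j i (H : nth_outside V l j i) :
  forall j' i', nth_outside V l j' i' -> ((j < j')%nat <-> (i < i')%nat).
Proof.
  induction H as [a l Ha | a l j i Ha H IH | a l j i Ha H IH]; intros j' i' H';
    inversion H'; subst; try contradiction; try lia.
  - apply IH in H5. lia.
  - apply IH in H5. lia.
Qed.

Lemma nth_outside_fun V l j i i' :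
  nth_outside V l j i -> nth_outside V l j i' -> i = i'.
Proof.
  intros H H'.
  pose proof (nth_outside_mono _ _ _ _ H _ _ H').
  pose proof (nth_outside_mono _ _ _ _ H' _ _ H). lia.
Qed.

Lemma nth_outside_all V l :
  Forall (fun a => ~ V a) l -> forall i, (i < length l)%nat -> nth_outside V l i i.
Proof.
  induction 1 as [|a l Ha H IH]; simpl; intros i Hi; [lia|].
  destruct i; [now apply nth_outside_here|].
  apply nth_outside_out; auto. apply IH; lia.
Qed.

Lemma nth_outside_all_eq V l j i :
  Forall (fun a => ~ V a) l -> nth_outside V l j i -> i = j.
Proof.
  intros H H1. induction H1; auto; inversion H; subst; auto; try contradiction.
Qed.

(** When the sets [Us] avoid [V], the letters outside [V] are exactly the matched ones, so the
    matching can be read off the word. [V] is the fixed reference; [V'] may be as small as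
    desired. *)
Lemma interleaved_nth V V' Us l (d : X) (HV : forall a, V' a -> V a) :
  interleaved V' Us l -> Forall (fun U => forall a, U a -> ~ V a) Us ->
  forall j, (j < length Us)%nat ->
  exists i, nth_outside V l j i /\ nth j Us (fun _ => False) (nth i l d).
Proof.
  induction 1 as [|Us a l Ha H IH|U Us a l Ha H IH]; intros HU j Hj; simpl in Hj.
  - lia.
  - destruct (IH HU j Hj) as [i [H1 H2]]. exists (S i); split; auto.
    apply nth_outside_in; auto.
  - inversion HU as [|U' Us' HU0 HUs]; subst. destruct j.
    + exists 0%nat. split; auto. apply nth_outside_here; auto.
    + destruct (IH HUs j) as [i [H1 H2]]; [lia|]. exists (S i). split; auto.
      apply nth_outside_out; auto.
Qed.

Lemma interleaved_cover V V' Us l (d : X) (HV : forall a, V' a -> V a) :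
  interleaved V' Us l -> Forall (fun U => forall a, U a -> ~ V a) Us ->
  forall i, (i < length l)%nat ->
  V' (nth i l d) \/ exists j, (j < length Us)%nat /\ nth_outside V l j i.
Proof.
  induction 1 as [|Us a l Ha H IH|U Us a l Ha H IH]; intros HU i Hi; simpl in Hi.
  - lia.
  - destruct i; [now left|]. destruct (IH HU i) as [H1|[j [H1 H2]]]; [lia|now left|].
    right. exists j. split; auto. apply nth_outside_in; auto.
  - inversion HU as [|U' Us' HU0 HUs]; subst. destruct i.
    + right. exists 0%nat. simpl. split; [lia|]. apply nth_outside_here; auto.
    + destruct (IH HUs i) as [H1|[j [H1 H2]]]; [lia|now left|].
      right. exists (S j). simpl. split; [lia|]. apply nth_outside_out; auto.
Qed.

(* [l0] is the word at the centre of a chart, all of its letters being outside [V0]; [l] is a nearby word. *)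
Lemma interleaved_refine V V0 V' Us l l0
    (HV0 : forall a, V' a -> V0 a) (HV : forall a, V' a -> V a) :
  interleaved V' Us l ->
  Forall2 (fun U b => (forall a, U a -> ~ V0 a) /\
     (V b -> forall a, U a -> V a) /\ (~ V b -> forall a, U a -> ~ V a)) Us l0 ->
  forall j i i', nth_outside V l0 j i -> nth_outside V0 l i i' -> nth_outside V l j i'.
Proof.
  intros H. revert l0.
  induction H as [|Us a l Ha H IH|U Us a l Ha H IH]; intros l0 HF j i i' H1 H2.
  - inversion H2.
  - assert (Ha0 : V0 a) by auto.
    inversion H2; subst; try contradiction.
    apply nth_outside_in; auto. eapply IH; eauto.
  - inversion HF as [|U' b Us' l0' [Hb1 [Hb2 Hb3]] HF']; subst.
    assert (Ha0 : ~ V0 a) by auto.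
    inversion H1; subst; inversion H2; subst; try contradiction.
    + apply nth_outside_here; auto.
    + apply nth_outside_out; auto. eapply IH; eauto.
    + apply nth_outside_in; auto. eapply IH; eauto.
Qed.

(** Applied with [same_letter] as [P]. Ranks outside a neighbourhood would not do there, since a
    delayed letter may be close to [e] or equal to it. *)
Lemma interleaved_of_positions V l (d : X) : forall Us (P : nat -> nat -> Prop),
  (forall j, (j < length Us)%nat -> exists i, (i < length l)%nat /\ P j i /\
      nth j Us (fun _ => False) (nth i l d)) ->
  (forall i, (i < length l)%nat -> V (nth i l d) \/ exists j, (j < length Us)%nat /\ P j i) ->
  (forall j i j' i', P j i -> P j' i' -> ((j < j')%nat <-> (i < i')%nat)) ->
  interleaved V Us l.
Proof.
  induction l as [|a l IH]; intros Us P H1 H2 H3.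
  - destruct Us; [constructor|]. destruct (H1 0%nat) as [i [Hi _]]; simpl in *; lia.
  - destruct (classic (exists j, (j < length Us)%nat /\ P j 0%nat)) as [[j [Hj HP]]|HN].
    + destruct Us as [|U Us]; [simpl in Hj; lia|].
      assert (j = 0%nat) as ->.
      { destruct (H1 0%nat) as [i [_ [Hi _]]]; [simpl; lia|].
        pose proof (H3 _ _ _ _ Hi HP). lia. }
      apply interleaved_take.
      * destruct (H1 0%nat) as [i [_ [Hi HU]]]; [simpl; lia|].
        assert (i = 0%nat) as ->; [|exact HU].
        pose proof (H3 _ _ _ _ Hi HP). pose proof (H3 _ _ _ _ HP Hi). lia.
      * apply (IH Us (fun j i => P (S j) (S i))).
        -- intros j Hj'. destruct (H1 (S j)) as [i [Hi [Hi' HU]]]; [simpl; lia|].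
           pose proof (H3 _ _ _ _ HP Hi'). destruct i; [lia|]. exists i.
           simpl in *. repeat split; auto; lia.
        -- intros i Hi. destruct (H2 (S i)) as [Hv|[j [Hj' HP']]]; [simpl; lia|now left|].
           right. pose proof (H3 _ _ _ _ HP HP'). destruct j; [lia|].
           exists j. simpl in Hj'. split; [lia|auto].
        -- intros j i j' i' Ha Hb. pose proof (H3 _ _ _ _ Ha Hb). lia.
    + apply interleaved_skip.
      * destruct (H2 0%nat) as [Hv|Hc]; [simpl; lia|exact Hv|contradiction].
      * apply (IH Us (fun j i => P j (S i))).
        -- intros j Hj. destruct (H1 j Hj) as [i [Hi [Hi' HU]]].
           destruct i; [exfalso; eauto|]. exists i. simpl in *. repeat split; auto; lia.
        -- intros i Hi. destruct (H2 (S i)) as [Hv|Hc]; [simpl; lia|now left|now right].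
        -- intros j i j' i' Ha Hb. pose proof (H3 _ _ _ _ Ha Hb). lia.
Qed.

Lemma interleaved_unstrip (e : X) V Us l (He : V e) :
  interleaved V Us (strip e l) -> interleaved V Us l.
Proof.
  revert Us. induction l as [|a l IH]; simpl; intros Us H; auto.
  destruct (excluded_middle_informative (a = e)) as [->|Ha].
  - apply interleaved_skip; auto.
  - inversion H; subst; [apply interleaved_skip|apply interleaved_take]; auto.
Qed.

Lemma interleaved_strip (e : X) V Us l :
  Forall (fun U => ~ U e) Us -> interleaved V Us l -> interleaved V Us (strip e l).
Proof.
  intros HU H. induction H as [|Us a l Ha H IH|U Us a l Ha H IH]; simpl.
  - constructor.
  - destruct (excluded_middle_informative (a = e)) as [->|Hn]; auto.
    apply interleaved_skip; auto.
  - inversion HU; subst.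
    destruct (excluded_middle_informative (a = e)) as [->|Hn]; [contradiction|].
    apply interleaved_take; auto.
Qed.

Lemma strip_id (e : X) l : Forall (fun x => x <> e) l -> strip e l = l.
Proof.
  induction 1 as [|a l Ha H IH]; simpl; auto.
  destruct (excluded_middle_informative (a = e)); [contradiction|congruence].
Qed.

Lemma strip_const (e : X) l : (forall i, (i < length l)%nat -> nth i l e = e) -> strip e l = nil.
Proof.
  induction l as [|a l IH]; simpl; intros H; auto.
  pose proof (H 0%nat ltac:(lia)) as H0. simpl in H0.
  destruct (excluded_middle_informative (a = e)); [|contradiction].
  apply IH. intros i Hi. apply (H (S i)). lia.
Qed.

Lemma strip_single (e : X) l k : (k < length l)%nat ->
  (forall i, (i < length l)%nat -> i <> k -> nth i l e = e) ->
  strip e l = strip e (nth k l e :: nil).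
Proof.
  revert k. induction l as [|a l IH]; intros k Hk H; simpl in Hk; [lia|].
  destruct k.
  - simpl. rewrite (strip_const e l); auto.
    intros i Hi. apply (H (S i)); simpl; lia.
  - pose proof (H 0%nat ltac:(simpl; lia) ltac:(lia)) as H0. simpl in H0.
    change (nth (S k) (a :: l) e) with (nth k l e). rewrite <- (IH k).
    + simpl. destruct (excluded_middle_informative (a = e)); [auto|contradiction].
    + lia.
    + intros i Hi Hik. apply (H (S i)); simpl; lia.
Qed.

Lemma strip_in (e : X) l a : In a l -> a = e \/ In a (strip e l).
Proof.
  induction l as [|b l IH]; simpl; [tauto|].
  intros [->|H].
  - destruct (excluded_middle_informative (a = e)); [auto|right; now left].
  - destruct (IH H) as [|H']; auto.
    destruct (excluded_middle_informative (b = e)); [auto|right; now right].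
Qed.

Lemma Forall2_choice {A : Type} (P : A -> X -> Prop) l :
  (forall x, In x l -> exists u, P u x) -> exists us, Forall2 P us l.
Proof.
  induction l as [|a l IH]; intros H; [exists nil; constructor|].
  destruct (H a (or_introl eq_refl)) as [u Hu].
  destruct IH as [us Hus]; [intros x Hx; apply H; now right|].
  exists (u :: us). now constructor.
Qed.

End Words.

(** * Neighbourhoods in the James reduced product *)

Section JamesTopology.
Context {X : Type} (O : (X -> Prop) -> Prop) (e : X).
Context (HO : is_topology O) (HT2 : hausdorff O).
Implicit Types (V U : X -> Prop) (Us : list (X -> Prop)) (l : list X) (a : X).

(** The quotient maps [qn] for all [n] at once. *)
Definition to_word l : word X e := exist _ (strip e l) (strip_ok e l).

Lemma word_eq (w w' : word X e) : proj1_sig w = proj1_sig w' -> w = w'.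
Proof.
  destruct w as [l H], w' as [l' H']; simpl. intros ->. f_equal. apply proof_irrelevance.
Qed.

Lemma to_word_val (w : word X e) : to_word (proj1_sig w) = w.
Proof. apply word_eq. simpl. apply strip_id. apply (proj2_sig w). Qed.

Lemma open_true : O (fun _ => True).
Proof. apply HO. Qed.

Lemma open_and U V : O U -> O V -> O (fun x => U x /\ V x).
Proof. apply HO. Qed.

(** Used to isolate a list among all lists spelled with a given finite alphabet. *)
Lemma avoid_finite a (L : list X) :
  exists U, O U /\ U a /\ forall b, In b L -> U b -> b = a.
Proof.
  induction L as [|c L [U [HU [Ha HL]]]].
  - exists (fun _ => True). split; [apply open_true|]. split; auto. intros b [].
  - destruct (classic (c = a)) as [->|Hc].
    + exists U. do 2 (split; auto). intros b [<-|Hb]; auto.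
    + destruct (HT2 a c) as [A [C [HA [HC [HAa [HCc Hd]]]]]]; auto.
      exists (fun x => U x /\ A x). split; [now apply open_and|]. split; auto.
      intros b [<-|Hb] [H1 H2]; auto. exfalso; eapply Hd; eauto.
Qed.

Lemma separate_from_base l : Forall (fun x => x <> e) l ->
  exists V, O V /\ V e /\
  exists Us, Forall2 (fun U a => O U /\ U a /\ forall b, U b -> ~ V b) Us l.
Proof.
  induction 1 as [|a l Ha Hl [V [HV [HVe [Us HUs]]]]].
  - exists (fun _ => True). split; [apply open_true|]. split; auto. exists nil; constructor.
  - destruct (HT2 a e Ha) as [A [C [HA [HC [HAa [HCc Hd]]]]]].
    exists (fun x => V x /\ C x). split; [now apply open_and|]. split; auto.
    exists (A :: Us). constructor.
    + repeat split; auto. intros b Hb [_ Hb']. eapply Hd; eauto.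
    + eapply Forall2_impl; [|exact HUs]. intros U b [H1 [H2 H3]].
      repeat split; auto. intros c Hc [Hc' _]. eapply H3; eauto.
Qed.

(** The topology of the disjoint union of all powers of [X]: [Forall2] fixes the length. *)
Definition box_open (P : list X -> Prop) : Prop :=
  forall l, P l -> exists Us, Forall O Us /\ Forall2 (fun U a => U a) Us l /\
    forall l', Forall2 (fun U a => U a) Us l' -> P l'.

(** The weak topology of the quotients [Jn] is the quotient topology of the disjoint union of all
    powers. The double negations come from defining open sets through closed complements. *)
Lemma J_open_box (W : word X e -> Prop) :
  J_open X O e W <-> box_open (fun l => W (to_word l)).
Proof.
  split.
  - intros H l Hl. destruct (H (length l) (exist _ l eq_refl)) as [Us [H1 [H2 H3]]].
    + intros Hn. apply Hn. exact Hl.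
    + exists Us. do 2 (split; auto). intros l' Hl'.
      assert (Hlen : length l' = length l).
      { rewrite <- (Forall2_length Hl'). apply (Forall2_length H2). }
      apply NNPP. exact (H3 (exist _ l' Hlen) Hl').
  - intros H n [l Hl] Hx. apply NNPP in Hx. destruct (H l Hx) as [Us [H1 [H2 H3]]].
    exists Us. do 2 (split; auto). intros [l' Hl'] Hy Hn. apply Hn. apply (H3 l' Hy).
Qed.

(** One interleaving of [l] assigns to each letter either [V] or a member of [Us]; the product of
    these sets is the required box. *)
Lemma interleaved_box_open V Us : O V -> Forall O Us -> box_open (interleaved V Us).
Proof.
  intros HV HU l H. induction H as [|Us a l Ha H IH|U Us a l Ha H IH].
  - exists nil. do 2 (split; auto). intros l' H; inversion H; constructor.
  - destruct (IH HU) as [Ls [H1 [H2 H3]]]. exists (V :: Ls).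
    do 2 (split; [now constructor|]). intros l' H'; inversion H'; subst.
    apply interleaved_skip; auto.
  - inversion HU as [|U' Us' HU0 HUs]; subst.
    destruct (IH HUs) as [Ls [H1 [H2 H3]]]. exists (U :: Ls).
    do 2 (split; [now constructor|]). intros l' H'; inversion H'; subst.
    apply interleaved_take; auto.
Qed.

(** Openness is tested on lists that may contain [e]. Such letters can be inserted because [V]
    contains [e], and deleted because no member of [Us] does. *)
Lemma J_open_interleaved V Us :
  O V -> V e -> Forall O Us -> Forall (fun U => ~ U e) Us ->
  J_open X O e (fun w => interleaved V Us (proj1_sig w)).
Proof.
  intros HV HVe HU HUe. apply J_open_box. intros l Hl. simpl in Hl.
  apply interleaved_unstrip in Hl; auto.
  destruct (interleaved_box_open V Us HV HU l Hl) as [Ls [H1 [H2 H3]]].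
  exists Ls. do 2 (split; auto). intros l' Hl'. simpl. apply interleaved_strip; auto.
Qed.

(** [interleaved] with the choices recorded, [false] marking an inserted letter, so that they can be
    enumerated for lists of bounded length. *)
Inductive interleaved_by V : list bool -> list (X -> Prop) -> list X -> Prop :=
| by_nil : interleaved_by V nil nil nil
| by_skip : forall bs Us a l,
    V a -> interleaved_by V bs Us l -> interleaved_by V (false :: bs) Us (a :: l)
| by_take : forall bs U Us a l,
    U a -> interleaved_by V bs Us l -> interleaved_by V (true :: bs) (U :: Us) (a :: l).

Lemma interleaved_pattern V Us l :
  interleaved V Us l -> exists bs, length bs = length l /\ interleaved_by V bs Us l.
Proof.
  induction 1 as [|Us a l Ha H [bs [H1 H2]]|U Us a l Ha H [bs [H1 H2]]].
  - exists nil. split; constructor.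
  - exists (false :: bs). simpl. split; [lia|]. now constructor.
  - exists (true :: bs). simpl. split; [lia|]. now constructor.
Qed.

Lemma interleaved_by_weaken V V' bs Us Us' l :
  (forall a, V a -> V' a) ->
  Forall2 (fun U U' : X -> Prop => forall a, U a -> U' a) Us Us' ->
  interleaved_by V bs Us l -> interleaved_by V' bs Us' l.
Proof.
  intros HV HF H. revert Us' HF.
  induction H; intros Us' HF; inversion HF; subst; constructor; auto.
Qed.

Lemma refinement_refl Us : Forall2 (fun U U' : X -> Prop => forall a, U a -> U' a) Us Us.
Proof. induction Us; constructor; auto. Qed.

Lemma patterns_finite N :
  exists B : list (list bool), forall bs, (length bs <= N)%nat -> In bs B.
Proof.
  induction N as [|N [B HB]].
  - exists [nil]. intros [|b bs] H; simpl in *; [auto|lia].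
  - exists (nil :: map (cons true) B ++ map (cons false) B).
    intros [|b bs] H; simpl in *; [auto|]. right. apply in_or_app.
    destruct b; [left|right]; apply in_map; apply HB; lia.
Qed.

Definition nbhds Us l := Forall2 (fun U a => O U /\ U a) Us l.

Lemma nbhds_true l : exists Us, nbhds Us l.
Proof.
  apply Forall2_choice. intros x _. exists (fun _ => True). split; auto. apply open_true.
Qed.

Lemma nbhds_and Us Us' l : nbhds Us l -> nbhds Us' l ->
  exists Us'', nbhds Us'' l /\
   Forall2 (fun U U' : X -> Prop => forall a, U a -> U' a) Us'' Us /\
   Forall2 (fun U U' : X -> Prop => forall a, U a -> U' a) Us'' Us'.
Proof.
  intros H. revert Us'. induction H as [|U a Us l [H1 H2] H IH]; intros Us' H'.
  - inversion H'; subst. exists nil. repeat split; constructor.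
  - inversion H' as [|U' a' Us1 l' [H3 H4] H5]; subst.
    destruct (IH _ H5) as [Us'' [Ha [Hb Hc]]].
    exists ((fun x => U x /\ U' x) :: Us'').
    repeat split; constructor; auto; try tauto.
    split; auto. now apply open_and.
Qed.

(** Whether a pattern fits depends only on its number of entries [true]. Hence a pattern that does
    not fit [z] is followed by no nearby list, which settles the vacuous case of [pattern_nbhd]. *)
Lemma pattern_nbhd_exists V bs Us l z :
  nbhds Us z -> interleaved_by V bs Us l ->
  exists l', interleaved_by (eq e) bs (map eq z) l'.
Proof.
  intros HF H. revert z HF.
  induction H as [|bs Us a l Ha H IH|bs U Us a l Ha H IH]; intros z HF.
  - inversion HF; subst. exists nil; constructor.
  - destruct (IH z HF) as [l' Hl']. exists (e :: l'). now constructor.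
  - inversion HF as [|U' b Us' z' Hb HF']; subst. destruct (IH _ HF') as [l' Hl'].
    exists (b :: l'). simpl. now constructor.
Qed.

(** All inserted letters share a single [V], namely the intersection of the factors of the box at
    the inserted places. *)
Lemma pattern_nbhd_box bs z l Ls :
  interleaved_by (eq e) bs (map eq z) l -> nbhds Ls l ->
  exists V Us, O V /\ V e /\ nbhds Us z /\
    forall y, interleaved_by V bs Us y -> Forall2 (fun U a => U a) Ls y.
Proof.
  intros H. remember (map eq z) as zs eqn:Hz. revert z Hz Ls.
  induction H as [|bs Us a l Ha H IH|bs U Us a l Ha H IH]; intros z Hz Ls HL.
  - destruct z; [|discriminate]. inversion HL; subst.
    exists (fun _ => True), nil. split; [apply open_true|]. repeat split; [constructor|].
    intros y Hy; inversion Hy; constructor.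
  - inversion HL as [|L a' Ls' l' [HL1 HL2] HL']; subst.
    destruct (IH z eq_refl _ HL') as [V [Us [HV [HVe [HUs Hy]]]]].
    exists (fun x => V x /\ L x), Us. split; [now apply open_and|]. repeat split; auto.
    intros y H'; inversion H'; subst. constructor; [tauto|]. apply Hy.
    eapply interleaved_by_weaken; [|apply refinement_refl|eassumption]. tauto.
  - destruct z as [|b z]; [discriminate|]. simpl in Hz. injection Hz as -> ->.
    inversion HL as [|L a' Ls' l' [HL1 HL2] HL']; subst.
    destruct (IH z eq_refl _ HL') as [V [Us [HV [HVe [HUs Hy]]]]].
    exists V, (L :: Us). repeat split; auto. { constructor; auto. }
    intros y H'; inversion H'; subst. constructor; auto.
Qed.

Lemma pattern_nbhd (P : list X -> Prop) z bs : box_open P ->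
  (forall l, interleaved_by (eq e) bs (map eq z) l -> P l) ->
  exists V Us, O V /\ V e /\ nbhds Us z /\ forall l, interleaved_by V bs Us l -> P l.
Proof.
  intros HP Hz.
  destruct (classic (exists l, interleaved_by (eq e) bs (map eq z) l)) as [[l Hl]|HN].
  - destruct (HP l (Hz l Hl)) as [Ls [H1 [H2 H3]]].
    destruct (pattern_nbhd_box bs z l Ls Hl) as [V [Us [HV [HVe [HUs Hy]]]]].
    + clear - H1 H2. unfold nbhds. induction H2; inversion H1; subst; constructor; auto.
    + exists V, Us. repeat split; auto.
  - destruct (nbhds_true z) as [Us HUs].
    exists (fun _ => True), Us. split; [apply open_true|]. repeat split; auto.
    intros l Hl. exfalso. apply HN. eapply pattern_nbhd_exists; eauto.
Qed.

(** With singletons as sets, [interleaved] says that [l] is [z] with copies of [e] inserted. *)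
Lemma strip_pad z l : interleaved (eq e) (map eq z) l -> strip e l = strip e z.
Proof.
  intros H. remember (map eq z) as zs eqn:Hz. revert z Hz.
  induction H as [|Us a l Ha H IH|U Us a l Ha H IH]; intros z Hz.
  - destruct z; [auto|discriminate].
  - simpl. subst a. destruct (excluded_middle_informative (e = e)); [auto|congruence].
  - destruct z as [|b z]; [discriminate|]. simpl in Hz. injection Hz as -> ->. subst a.
    simpl. rewrite (IH z eq_refl). reflexivity.
Qed.

(* The length bound leaves finitely many insertion patterns, whose neighbourhoods can be intersected. *)
Lemma J_open_interleaved_nbhd (W : word X e -> Prop) z N :
  J_open X O e W -> W (to_word z) ->
  exists V Us, O V /\ V e /\ nbhds Us z /\
    forall l, (length l <= N)%nat -> interleaved V Us l -> W (to_word l).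
Proof.
  intros HW Hz. apply J_open_box in HW.
  assert (HB : forall B : list (list bool), exists V Us, O V /\ V e /\ nbhds Us z /\
     forall bs l, In bs B -> interleaved_by V bs Us l -> W (to_word l)).
  { induction B as [|bs B [V [Us [HV [HVe [HUs HB]]]]]].
    - destruct (nbhds_true z) as [Us HUs]. exists (fun _ => True), Us.
      split; [apply open_true|]. repeat split; auto. intros bs l [].
    - destruct (pattern_nbhd (fun l => W (to_word l)) z bs HW)
        as [V' [Us' [HV' [HVe' [HUs' HB']]]]].
      + intros l Hl. assert (Hs : interleaved (eq e) (map eq z) l).
        { clear - Hl. induction Hl;
            [constructor|apply interleaved_skip|apply interleaved_take]; auto. }
        replace (to_word l) with (to_word z); auto.
        apply word_eq. simpl. symmetry. now apply strip_pad.
      + destruct (nbhds_and _ _ _ HUs HUs') as [Us'' [H1 [H2 H3]]].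
        exists (fun x => V x /\ V' x), Us''. split; [now apply open_and|].
        repeat split; auto. intros bs' l [<-|Hin] Hl.
        * apply HB'. eapply interleaved_by_weaken; [|exact H3|exact Hl]. intros a [_ Ha]; exact Ha.
        * apply (HB bs'); auto. eapply interleaved_by_weaken; [|exact H2|exact Hl]. intros a [Ha _]; exact Ha. }
  destruct (patterns_finite N) as [B HBN]. destruct (HB B) as [V [Us [HV [HVe [HUs H]]]]].
  exists V, Us. repeat split; auto. intros l Hl Hi.
  destruct (interleaved_pattern _ _ _ Hi) as [bs [Hbs Hby]].
  apply (H bs); auto. apply HBN. lia.
Qed.

(** A list in a box around [l] can only represent [ws m] for [m < length l]. These finitely many
    words use finitely many letters, and the factors are chosen so that the only list in the box
    spelled with them is [l] itself. *)
Lemma J_open_avoid_sequence (ws : nat -> word X e) :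
  (forall m, (m < length (proj1_sig (ws m)))%nat) ->
  J_open X O e (fun w => forall m, w <> ws m).
Proof.
  intros Hlen. apply J_open_box. intros l Hl.
  (* [e] is included because the nearby list may contain letters that are stripped. *)
  set (F := e :: flat_map (fun m => proj1_sig (ws m)) (seq 0 (length l))).
  destruct (Forall2_choice (fun U a => (O U /\ U a) /\ forall b, In b F -> U b -> b = a) l)
    as [Us HUs].
  { intros a _. destruct (avoid_finite a F) as [U [H1 [H2 H3]]]. exists U. auto. }
  exists Us. split; [|split].
  - clearbody F. clear - HUs. induction HUs; constructor; tauto.
  - eapply Forall2_impl; [|exact HUs]. simpl; tauto.
  - intros l' Hl' m Hm. apply (Hl m). rewrite <- Hm. f_equal.
    assert (Hll : length l' = length l).
    { rewrite <- (Forall2_length Hl'). apply (Forall2_length HUs). }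
    assert (HF : forall b, In b l' -> In b F).
    { intros b Hb. destruct (strip_in e l' b Hb) as [->|Hb']; [now left|].
      right. apply in_flat_map. exists m. split.
      - apply in_seq. split; [lia|]. pose proof (Hlen m) as H. rewrite <- Hm in H.
        simpl in H. pose proof (strip_len e l'). lia.
      - rewrite <- Hm. exact Hb'. }
    clear - HUs Hl' HF. clearbody F. revert l' Hl' HF.
    induction HUs as [|U a Us l [_ H] HUs IH]; intros l' Hl' HF.
    + inversion Hl'; auto.
    + inversion Hl' as [|U' b Us' l'' Hb Hl'']; subst. f_equal.
      * symmetry. apply H; auto. apply HF. now left.
      * apply IH; auto. intros b' Hb'. apply HF. now right.
Qed.

(* Otherwise there would be a sequence of words of unbounded length converging to [g t0], but such a
   sequence is closed. *)
Lemma locally_bounded_length (g : R -> word X e) t0 :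
  (forall W, J_open X O e W -> W (g t0) ->
     exists eps, 0 < eps /\ forall t, Rabs (t - t0) < eps -> W (g t)) ->
  exists eps N, 0 < eps /\
    forall t, Rabs (t - t0) < eps -> (length (proj1_sig (g t)) <= N)%nat.
Proof.
  intros Hg. apply NNPP. intros HN.
  (* The summand [length (proj1_sig (g t0))] keeps [g t0] itself out of the sequence. *)
  assert (Ht : forall m : nat, exists t, Rabs (t - t0) < / (INR m + 1) /\
             (m + length (proj1_sig (g t0)) < length (proj1_sig (g t)))%nat).
  { intros m. apply NNPP. intros Hm. apply HN.
    exists (/ (INR m + 1)), (m + length (proj1_sig (g t0)))%nat. split.
    - apply Rinv_0_lt_compat. pose proof (pos_INR m). lra.
    - intros t Ht. apply Nat.nlt_ge. intros Hlt. apply Hm. exists t. auto. }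
  apply choice in Ht. destruct Ht as [ts Hts].
  destruct (Hg (fun w => forall m, w <> g (ts m))) as [eps [Heps H]].
  - apply (J_open_avoid_sequence (fun m => g (ts m))). intros m. destruct (Hts m). lia.
  - intros m Hm. destruct (Hts m) as [_ H]. rewrite <- Hm in H. lia.
  - destruct (archimed_cor1 eps Heps) as [m [Hm Hm0]].
    apply (H (ts m)) with m; auto. destruct (Hts m) as [H1 _].
    eapply Rlt_trans; [exact H1|]. eapply Rlt_trans; [|exact Hm].
    apply Rinv_lt_contravar.
    + apply lt_0_INR in Hm0. apply Rmult_lt_0_compat; lra.
    + lra.
Qed.

End JamesTopology.

(** * Compactness of intervals and local properties *)

(** Compactness in additive form. Only short intervals containing [x] are tested at [x], which suits
    properties that compare a time with a fixed centre. *)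
Lemma interval_induction (Q : R -> R -> Prop) :
  (forall x, exists eps, 0 < eps /\ forall a b, x - eps < a -> a <= x -> x <= b -> b < x + eps -> Q a b) ->
  (forall a b c, a <= b -> b <= c -> Q a b -> Q b c -> Q a c) ->
  forall a b, a <= b -> Q a b.
Proof.
  intros Hloc Hadd a b Hab.
  assert (Haa : Q a a). { destruct (Hloc a) as [eps [Heps H]]. apply H; lra. }
  destruct (completeness (fun x => a <= x <= b /\ Q a x)) as [m [Hub Hlub]].
  - exists b. intros x [Hx _]. lra.
  - exists a. split; auto; lra.
  - assert (Ham : a <= m) by (apply Hub; split; auto; lra).
    assert (Hmb : m <= b) by (apply Hlub; intros x [Hx _]; lra).
    destruct (Hloc m) as [eps [Heps H]].
    assert (Hx : exists x, a <= x <= b /\ Q a x /\ m - eps < x).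
    { apply NNPP. intros HN. assert (m <= m - eps); [|lra].
      apply Hlub. intros x [Hx HQ]. apply Rnot_lt_le. intros Hlt. apply HN. exists x; auto. }
    destruct Hx as [x [Hx [HQ Hxm]]].
    assert (Hxm' : x <= m) by (apply Hub; auto).
    assert (HQm : forall y, m <= y -> y <= b -> y < m + eps -> Q a y).
    { intros y H1 H2 H3. apply (Hadd a x y); try lra; auto. }
    destruct (Rle_lt_dec (m + eps / 2) b) as [Hle|Hlt].
    + assert (m + eps / 2 <= m); [|lra].
      apply Hub. split; [lra|]. apply HQm; lra.
    + apply HQm; lra.
Qed.

Definition near (t0 : R) (P : R -> Prop) : Prop :=
  exists eps, 0 < eps /\ forall t, Rabs (t - t0) < eps -> P t.

Lemma near_and t0 (P P' : R -> Prop) :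
  near t0 P -> near t0 P' -> near t0 (fun t => P t /\ P' t).
Proof.
  intros [e1 [H1 Ha]] [e2 [H2 Hb]]. exists (Rmin e1 e2).
  split; [now apply Rmin_glb_lt|]. intros t Ht.
  pose proof (Rmin_l e1 e2). pose proof (Rmin_r e1 e2).
  split; [apply Ha|apply Hb]; lra.
Qed.

Lemma near_mono t0 (P P' : R -> Prop) :
  (forall t, P t -> P' t) -> near t0 P -> near t0 P'.
Proof. intros H [eps [H1 H2]]. exists eps. auto. Qed.

Lemma near_refl t0 (P : R -> Prop) : near t0 P -> P t0.
Proof.
  intros [eps [H1 H2]]. apply H2. replace (t0 - t0) with 0 by ring. rewrite Rabs_R0. auto.
Qed.

Lemma near_ball t0 eps : 0 < eps -> near t0 (fun t => Rabs (t - t0) < eps).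
Proof. intros H. exists eps. auto. Qed.

Definition near2 (u0 s0 : R) (P : R -> R -> Prop) : Prop :=
  exists eps, 0 < eps /\ forall u s, Rabs (u - u0) < eps -> Rabs (s - s0) < eps -> P u s.

Definition continuous2_at (f : R -> R -> R) (u0 s0 : R) : Prop :=
  forall eps, 0 < eps -> near2 u0 s0 (fun u s => Rabs (f u s - f u0 s0) < eps).

Lemma near2_and u0 s0 (P P' : R -> R -> Prop) :
  near2 u0 s0 P -> near2 u0 s0 P' -> near2 u0 s0 (fun u s => P u s /\ P' u s).
Proof.
  intros [e1 [H1 Ha]] [e2 [H2 Hb]]. exists (Rmin e1 e2).
  split; [now apply Rmin_glb_lt|]. intros u s Hu Hs.
  pose proof (Rmin_l e1 e2). pose proof (Rmin_r e1 e2).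
  split; [apply Ha|apply Hb]; lra.
Qed.

Lemma near2_mono u0 s0 (P P' : R -> R -> Prop) :
  (forall u s, P u s -> P' u s) -> near2 u0 s0 P -> near2 u0 s0 P'.
Proof. intros H [eps [H1 H2]]. exists eps. auto. Qed.

Lemma near2_all {A : Type} u0 s0 (L : list A) (P : A -> R -> R -> Prop) :
  (forall c, In c L -> near2 u0 s0 (P c)) ->
  near2 u0 s0 (fun u s => forall c, In c L -> P c u s).
Proof.
  induction L as [|c L IH]; intros H.
  - exists 1. split; [lra|]. intros u s _ _ c [].
  - eapply near2_mono; [|apply near2_and; [apply (H c); now left|apply IH; intros d Hd; apply H; now right]].
    cbv beta. intros u s [H1 H2] d [<-|Hd]; auto.
Qed.

Lemma near2_comp (f : R -> R -> R) u0 s0 (P : R -> Prop) :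
  continuous2_at f u0 s0 -> near (f u0 s0) P -> near2 u0 s0 (fun u s => P (f u s)).
Proof.
  intros Hf [eps [Heps H]]. eapply near2_mono; [|exact (Hf eps Heps)].
  cbv beta. auto.
Qed.

(** Symmetric in [a] and [b], so that letters are followed forwards and backwards alike. *)
Definition between (a b s : R) : Prop := a <= s <= b \/ b <= s <= a.

(** * Following letters through time *)

Section Tracking.
Context {X : Type} (O : (X -> Prop) -> Prop) (e : X).
Context (HO : is_topology O) (HT2 : hausdorff O).
Context (g : R -> word X e).
Context (Hg : forall t0 W, J_open X O e W -> W (g t0) -> near t0 (fun t => W (g t))).
Implicit Types (V U : X -> Prop) (Us : list (X -> Prop)) (l : list X).

Definition letters (t : R) : list X := proj1_sig (g t).

(** Chosen once for each [t], as the reference by which the letters of [g t] are recognised in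
    nearby words. *)
Definition base_nbhd (t : R) : X -> Prop :=
  proj1_sig (constructive_indefinite_description _
    (separate_from_base O e HO HT2 (letters t) (proj2_sig (g t)))).

Lemma base_nbhd_spec t : O (base_nbhd t) /\ base_nbhd t e /\
  exists Us, Forall2 (fun U a => O U /\ U a /\ forall b, U b -> ~ base_nbhd t b) Us (letters t).
Proof.
  unfold base_nbhd. destruct constructive_indefinite_description as [V HV]. exact HV.
Qed.

Lemma base_nbhd_letters t : Forall (fun a => ~ base_nbhd t a) (letters t).
Proof.
  destruct (base_nbhd_spec t) as [_ [_ [Us H]]].
  induction H as [|U a Us l [H1 [H2 H3]] H IH]; constructor; auto.
Qed.

(** [Ws] is shrunk to sets that avoid [base_nbhd t0], hence avoid [e]; the interleaved words then
    form an open set, and continuity of [g] applies. *)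
Lemma near_interleaved t0 V Ws : O V -> V e -> nbhds O Ws (letters t0) ->
  exists Us, Forall2 (fun U U' : X -> Prop => forall a, U a -> U' a) Us Ws /\
    nbhds O Us (letters t0) /\ Forall (fun U => forall a, U a -> ~ base_nbhd t0 a) Us /\
    near t0 (fun t => interleaved (fun x => base_nbhd t0 x /\ V x) Us (letters t)).
Proof.
  intros HV HVe HWs. destruct (base_nbhd_spec t0) as [HB [HBe [Us0 HUs0]]].
  destruct (nbhds_and O HO Us0 Ws (letters t0)) as [Us [H1 [H2 H3]]]; auto.
  { eapply Forall2_impl; [|exact HUs0]. simpl; tauto. }
  assert (HD : Forall (fun U => forall a, U a -> ~ base_nbhd t0 a) Us).
  { clear - HUs0 H2. revert Us H2.
    induction HUs0 as [|U a Us0 l [_ [_ HU]] H IH]; intros Us H2; inversion H2; subst; constructor; auto. }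
  exists Us. do 3 (split; auto).
  apply (Hg t0 (fun w => interleaved (fun x => base_nbhd t0 x /\ V x) Us (proj1_sig w))).
  - apply (J_open_interleaved O e); auto.
    + now apply (open_and O HO).
    + clear - H1. unfold nbhds in H1. induction H1; constructor; tauto.
    + eapply Forall_impl; [|exact HD]. intros U HU He. exact (HU e He HBe).
  - fold (letters t0). clear - H1. unfold nbhds in H1.
    induction H1 as [|U a Us l H HUs IH]; [constructor|].
    apply interleaved_take; tauto.
Qed.

Lemma near_letters t0 V Ws : O V -> V e -> nbhds O Ws (letters t0) ->
  near t0 (fun t =>
    (forall i, (i < length (letters t0))%nat -> exists i',
        nth_outside (base_nbhd t0) (letters t) i i' /\
        nth i Ws (fun _ => False) (nth i' (letters t) e)) /\
    (forall i', (i' < length (letters t))%nat -> V (nth i' (letters t) e) \/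
       exists i, (i < length (letters t0))%nat /\ nth_outside (base_nbhd t0) (letters t) i i')).
Proof.
  intros HV HVe HW. destruct (near_interleaved t0 V Ws HV HVe HW) as [Us [H1 [_ [HD HN]]]].
  pose proof (Forall2_length H1) as HlenU. pose proof (Forall2_length HW) as HlenW.
  eapply near_mono; [|exact HN]. cbv beta. intros t Ht. split.
  - intros i Hi. destruct (interleaved_nth (base_nbhd t0) _ Us _ e
       (fun a (Ha : base_nbhd t0 a /\ V a) => proj1 Ha) Ht HD i) as [i' [H2 H3]]; [lia|].
    exists i'. split; auto. clear - H1 H3. revert i H3.
    induction H1 as [|U U' Us Us' H HU IH]; intros [|i] Hi; simpl in *; auto.
  - intros i' Hi'. destruct (interleaved_cover (base_nbhd t0) _ Us _ e
       (fun a (Ha : base_nbhd t0 a /\ V a) => proj1 Ha) Ht HD i' Hi') as [[_ H]|[i [H2 H3]]]; [now left|].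
    right. exists i. split; auto. lia.
Qed.

(** [iota s0] is used as a position at [s0] and as a rank nearby. The two agree because all letters
    of [g s0] lie outside [base_nbhd s0]. Positions may jump, as new letters appear in front. *)
Definition tracking (a b : R) (iota : R -> nat) : Prop :=
  forall s0, between a b s0 -> near s0 (fun s => between a b s ->
    nth_outside (base_nbhd s0) (letters s) (iota s0) (iota s)).

Lemma tracking_sub a b a' b' iota : (forall s, between a' b' s -> between a b s) ->
  tracking a b iota -> tracking a' b' iota.
Proof.
  intros Hs H s0 H0. eapply near_mono; [|apply (H s0); auto]. cbv beta. auto.
Qed.

(** At [b] both pieces follow the same rank for the same reference; elsewhere a ball of radius
    [Rabs (s0 - b)] meets only one piece. *)
Lemma tracking_glue a b c iota iota' : between a c b -> iota b = iota' b ->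
  tracking a b iota -> tracking b c iota' ->
  exists iota'', tracking a c iota'' /\ iota'' a = iota a /\ iota'' c = iota' c.
Proof.
  intros Hb Heq H H'.
  exists (fun s => if excluded_middle_informative (between a b s) then iota s else iota' s).
  assert (Hab : between a b a) by (unfold between in *; lra).
  assert (Hbc : between b c c) by (unfold between in *; lra).
  split; [|split].
  - intros s0 Hs0.
    destruct (excluded_middle_informative (between a b s0)) as [H0|H0].
    + destruct (classic (s0 = b)) as [->|Hn].
      * eapply near_mono; [|apply near_and; [apply (H b)|apply (H' b)]];
          [|unfold between in *; lra..].
        cbv beta. intros s [Ha Ha'] Hs.
        destruct (excluded_middle_informative (between a b s)); auto.
        rewrite Heq. apply Ha'. unfold between in *; lra.
      * eapply near_mono; [|apply near_and; [apply (H s0); auto|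
           apply (near_ball s0 (Rabs (s0 - b))); apply Rabs_pos_lt; clear - Hn; lra]].
        cbv beta. intros s [Ha Hlt] Hs.
        destruct (excluded_middle_informative (between a b s)) as [Hy|Hy]; auto.
        exfalso. apply Hy. clear - Hlt Hs H0 Hb Hn.
        revert Hlt. unfold between, Rabs in *. destruct Rcase_abs, Rcase_abs; lra.
    + assert (Hn : s0 <> b) by (intros ->; apply H0; unfold between in *; lra).
      assert (H0' : between b c s0) by (unfold between in *; lra).
      eapply near_mono; [|apply near_and; [apply (H' s0); auto|
           apply (near_ball s0 (Rabs (s0 - b))); apply Rabs_pos_lt; clear - Hn; lra]].
      cbv beta. intros s [Ha Hlt] Hs.
      destruct (excluded_middle_informative (between a b s)) as [Hy|Hy].
      * exfalso. clear - Hlt Hs H0 Hb Hn Hy Hs0.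
        revert Hlt. unfold between, Rabs in *. destruct Rcase_abs, Rcase_abs; lra.
      * apply Ha. unfold between in *; lra.
  - destruct excluded_middle_informative; [auto|contradiction].
  - destruct (excluded_middle_informative (between a b c)) as [Hc|Hc]; auto.
    assert (c = b) as -> by (unfold between in *; lra). auto.
Qed.

(** Letters never overtake each other: near each time both positions have fixed ranks for the same
    reference, and ranks are ordered as positions are. *)
Lemma tracking_lt a b iota iota' : tracking a b iota -> tracking a b iota' ->
  (iota a < iota' a)%nat -> (iota b < iota' b)%nat.
Proof.
  intros H H' Hlt.
  set (lo := Rmin a b). set (hi := Rmax a b).
  assert (Hbt : forall s, lo <= s -> s <= hi -> between a b s).
  { intros s. unfold lo, hi, between, Rmin, Rmax. destruct Rle_dec; lra. }
  (* An equivalence, so that comparisons chain through the centre and the case [b < a] is covered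
     too. *)
  assert (HQ : forall x y, x <= y -> lo <= x -> y <= hi ->
            ((iota x < iota' x)%nat <-> (iota y < iota' y)%nat)).
  { apply (interval_induction (fun x y => lo <= x -> y <= hi ->
            ((iota x < iota' x)%nat <-> (iota y < iota' y)%nat))).
    - intros x. destruct (classic (lo <= x /\ x <= hi)) as [[Hx1 Hx2]|Hx].
      + destruct (near_and _ _ _ (H x (Hbt x Hx1 Hx2)) (H' x (Hbt x Hx1 Hx2))) as [eps [Heps Hn]].
        exists eps. split; auto.
        assert (Hloc : forall y, Rabs (y - x) < eps -> lo <= y -> y <= hi ->
            ((iota x < iota' x)%nat <-> (iota y < iota' y)%nat)).
        { intros y Hy Hy1 Hy2. destruct (Hn y Hy) as [Ha Ha'].
          eapply nth_outside_mono; [apply Ha|apply Ha']; auto. }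
        intros u v Hu1 Hu2 Hv1 Hv2 Hlo Hhi.
        rewrite <- (Hloc u), <- (Hloc v); try lra; [tauto|..];
          apply Rabs_def1; lra.
      + exists 1. split; [lra|]. intros u v H1 H2 H3 H4 H5 H6. exfalso. apply Hx. lra.
    - intros u v w Huv Hvw H1 H2 Hlo Hhi. rewrite H1, H2; try lra. tauto. }
  destruct (Rle_lt_dec a b) as [Hab|Hab].
  - apply (HQ a b); auto; unfold lo, hi, Rmin, Rmax; destruct Rle_dec; lra.
  - apply (HQ b a); auto; [lra|..]; unfold lo, hi, Rmin, Rmax; destruct Rle_dec; lra.
Qed.

Lemma tracking_eq a b iota iota' : tracking a b iota -> tracking a b iota' ->
  iota a = iota' a -> iota b = iota' b.
Proof.
  intros H H' Heq.
  assert (Hba : forall j, tracking a b j -> tracking b a j).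
  { intros j. apply tracking_sub. unfold between; tauto. }
  destruct (Nat.lt_trichotomy (iota b) (iota' b)) as [Hl|[Hl|Hl]]; auto.
  - apply (tracking_lt b a) in Hl; auto. lia.
  - apply (tracking_lt b a) in Hl; auto. lia.
Qed.

(* The letter at position [i] of [g t] and the one at position [i'] of [g t'] are the same moving letter. *)
Definition same_letter (t : R) (i : nat) (t' : R) (i' : nat) : Prop :=
  exists iota, tracking t t' iota /\ iota t = i /\ iota t' = i'.

Lemma same_letter_refl t i : (i < length (letters t))%nat -> same_letter t i t i.
Proof.
  intros Hi. exists (fun _ => i). repeat split; auto. intros s0 Hs0.
  assert (s0 = t) as -> by (unfold between in *; lra).
  exists 1. split; [lra|]. intros s _ Hs.
  assert (s = t) as -> by (unfold between in *; lra).
  apply nth_outside_all; auto. apply base_nbhd_letters.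
Qed.

Lemma same_letter_sym t i t' i' : same_letter t i t' i' -> same_letter t' i' t i.
Proof.
  intros [iota [H [H1 H2]]]. exists iota. repeat split; auto.
  eapply tracking_sub; [|exact H]. unfold between; tauto.
Qed.

(** If [t'] lies between the other two times, the trackings are glued. Otherwise one of them already
    covers all three times, and uniqueness identifies the positions. *)
Lemma same_letter_trans t i t' i' t'' i'' :
  same_letter t i t' i' -> same_letter t' i' t'' i'' -> same_letter t i t'' i''.
Proof.
  intros [iota [H [H1 H2]]] [iota' [H' [H1' H2']]].
  assert (Hc : between t t'' t' \/ between t t' t'' \/ between t' t'' t) by (unfold between; lra).
  destruct Hc as [Hc|[Hc|Hc]].
  - destruct (tracking_glue t t' t'' iota iota') as [j [Hj [Hj1 Hj2]]]; auto; [congruence|].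
    exists j. split; auto. split; congruence.
  - exists iota. split; [|split; auto].
    + eapply tracking_sub; [|exact H]. intros x Hx. unfold between in *; lra.
    + rewrite <- H2'. apply (tracking_eq t' t''); auto; [|congruence].
      eapply tracking_sub; [|exact H]. intros x Hx. unfold between in *; lra.
  - exists iota'. split; [|split; auto].
    + eapply tracking_sub; [|exact H']. intros x Hx. unfold between in *; lra.
    + rewrite <- H1. apply (tracking_eq t' t); [| |congruence].
      * eapply tracking_sub; [|exact H']. intros x Hx. unfold between in *; lra.
      * eapply tracking_sub; [|exact H]. intros x Hx. unfold between in *; lra.
Qed.

Lemma same_letter_valid t i t' i' : same_letter t i t' i' -> (i' < length (letters t'))%nat.
Proof.
  intros [iota [H [H1 H2]]]. specialize (H t' ltac:(unfold between; lra)).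
  apply near_refl in H. specialize (H ltac:(unfold between; lra)).
  apply nth_outside_lt in H. congruence.
Qed.

Lemma same_letter_fun t i i' : same_letter t i t i' -> i = i'.
Proof. intros [iota [_ [H1 H2]]]. congruence. Qed.

Lemma same_letter_lt t i j t' i' j' :
  same_letter t i t' i' -> same_letter t j t' j' -> ((i < j)%nat <-> (i' < j')%nat).
Proof.
  assert (HA : forall t i j t' i' j', same_letter t i t' i' -> same_letter t j t' j' ->
            (i < j)%nat -> (i' < j')%nat).
  { clear. intros t i j t' i' j' [u [H [H1 H2]]] [v [H' [H1' H2']]] Hlt. subst.
    eapply tracking_lt; eauto. }
  intros H H'. split; eapply HA; eauto using same_letter_sym.
Qed.

Lemma same_letter_convex t i t' i' s : between t t' s -> same_letter t i t' i' ->
  exists j, same_letter t i s j.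
Proof.
  intros Hs [iota [H [H1 H2]]]. exists (iota s), iota. repeat split; auto.
  eapply tracking_sub; [|exact H]. intros x Hx. unfold between in *; lra.
Qed.

(** Change of reference: [V] belongs to another centre. The letters of [g t0] outside [V] must be
    interior to its complement, lest they slip into [V]. *)
Lemma near_refine t0 V :
  O V -> V e ->
  (forall a, In a (letters t0) -> ~ V a -> exists U, O U /\ U a /\ forall b, U b -> ~ V b) ->
  near t0 (fun t => forall j i i', nth_outside V (letters t0) j i ->
     nth_outside (base_nbhd t0) (letters t) i i' -> nth_outside V (letters t) j i').
Proof.
  intros HV HVe Hgood.
  destruct (Forall2_choice (fun U a => (O U /\ U a) /\ (V a -> forall b, U b -> V b) /\
     (~ V a -> forall b, U b -> ~ V b)) (letters t0)) as [Ws HWs].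
  { intros a Ha. destruct (classic (V a)) as [Hv|Hv].
    - exists V. repeat split; auto.
    - destruct (Hgood a Ha Hv) as [U [H1 [H2 H3]]]. exists U. repeat split; auto. contradiction. }
  destruct (near_interleaved t0 V Ws) as [Us [H1 [_ [HD HN]]]]; auto.
  { eapply Forall2_impl; [|exact HWs]. simpl; tauto. }
  eapply near_mono; [|exact HN]. cbv beta. intros t Ht j i i' Hj Hi.
  eapply (interleaved_refine V (base_nbhd t0)); [| |exact Ht| |exact Hj|exact Hi].
  { now intros a [Ha _]. }
  { now intros a [_ Ha]. }
  clear - H1 HD HWs. revert Us H1 HD.
  induction HWs as [|W a Ws l [_ [Ha Hb]] HWs IH]; intros Us H1 HD;
    inversion H1; subst; inversion HD; subst; constructor; auto.
Qed.

(** A fixed rank with respect to [base_nbhd t0] defines positions on a whole interval around [t0];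
    [near_refine] turns this into the reference that [tracking] demands at each [s0]. *)
Lemma near_same_letter t0 : near t0 (fun t => forall i i', (i < length (letters t0))%nat ->
  nth_outside (base_nbhd t0) (letters t) i i' -> same_letter t0 i t i').
Proof.
  destruct (nbhds_true O HO (letters t0)) as [Ws HWs].
  destruct (near_interleaved t0 (fun _ => True) Ws) as [Us [H1 [HUs [HD [eps [Heps HN]]]]]]; auto.
  { apply (open_true O HO). }
  exists eps. split; auto. intros t Ht i i' Hi Hi'.
  pose proof (Forall2_length HUs) as HlenU.
  assert (Hex : forall s, exists k, Rabs (s - t0) < eps ->
             nth_outside (base_nbhd t0) (letters s) i k).
  { intros s. destruct (classic (Rabs (s - t0) < eps)) as [Hs|Hs]; [|exists 0%nat; tauto].
    destruct (interleaved_nth (base_nbhd t0) _ Us _ e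
       (fun a (Ha : base_nbhd t0 a /\ True) => proj1 Ha) (HN s Hs) HD i) as [k [H2 H3]]; [lia|]. now exists k. }
  apply choice in Hex. destruct Hex as [iota Hiota].
  exists iota. split; [|split].
  - intros s0 Hs0.
    assert (Hball : forall s, between t0 t s -> Rabs (s - t0) < eps).
    { intros s Hs. revert Ht. unfold between, Rabs in *. destruct Rcase_abs, Rcase_abs; lra. }
    destruct (base_nbhd_spec t0) as [HB [HBe _]].
    eapply near_mono; [|apply near_and;
       [apply (near_refine s0 (base_nbhd t0) HB HBe)|
        apply (near_letters s0 (fun _ => True) (map (fun _ _ => True) (letters s0)))]]; auto.
    + cbv beta. intros s [Ha [Hb _]] Hs.
      pose proof (Hiota s (Hball s Hs)) as Hk.
      pose proof (Hiota s0 (Hball s0 Hs0)) as Hk0.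
      destruct (Hb (iota s0)) as [k [Hk1 _]]; [eapply nth_outside_lt; eauto|].
      rewrite (nth_outside_fun _ _ _ _ _ Hk (Ha _ _ _ Hk0 Hk1)). exact Hk1.
    (* A letter outside the reference is a matched one, so it lies in a member of [Us], which is
       open and avoids the reference. *)
    + intros a Ha HnV. pose proof (HN s0 (Hball s0 Hs0)) as Hint.
      clear - Ha HnV Hint HUs HD. revert HD.
      assert (HO' : Forall O Us) by (clear - HUs; unfold nbhds in HUs; induction HUs; constructor; tauto).
      clear HUs. intros HD.
      induction Hint as [|Us a' l Ha' H IH|U Us a' l Ha' H IH].
      * destruct Ha.
      * destruct Ha as [<-|Ha]; [tauto|auto].
      * inversion HD; subst; inversion HO'; subst.
        destruct Ha as [<-|Ha]; [exists U; auto|auto].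
    + apply (open_true O HO).
    + clear - HO. induction (letters s0); constructor; auto. split; auto. apply (open_true O HO).
  - assert (H0 : Rabs (t0 - t0) < eps) by (rewrite Rminus_diag, Rabs_R0; auto).
    eapply nth_outside_all_eq; [|exact (Hiota t0 H0)]. apply base_nbhd_letters.
  - eapply nth_outside_fun; [exact (Hiota t Ht)|exact Hi'].
Qed.

Lemma near_moving_letters t0 V Ws : O V -> V e -> nbhds O Ws (letters t0) ->
  near t0 (fun t =>
    (forall i, (i < length (letters t0))%nat -> exists i',
        same_letter t0 i t i' /\ nth i Ws (fun _ => False) (nth i' (letters t) e)) /\
    (forall i', (i' < length (letters t))%nat -> V (nth i' (letters t) e) \/
       exists i, same_letter t0 i t i')).
Proof.
  intros HV HVe HW.
  eapply near_mono; [|exact (near_and _ _ _ (near_same_letter t0) (near_letters t0 V Ws HV HVe HW))].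
  cbv beta. intros t [Hs [Ha Hb]]. split.
  - intros i Hi. destruct (Ha i Hi) as [i' [H1 H2]]. exists i'. split; auto.
  - intros i' Hi'. destruct (Hb i' Hi') as [H|[i [H1 H2]]]; eauto.
Qed.

Definition alive (t0 : R) (i : nat) (t : R) : Prop := exists i', same_letter t0 i t i'.

Definition letter_path (t0 : R) (i : nat) (t : R) : X :=
  match excluded_middle_informative (alive t0 i t) with
  | left H => nth (proj1_sig (constructive_indefinite_description _ H)) (letters t) e
  | right _ => e
  end.

Lemma letter_path_eq t0 i t i' :
  same_letter t0 i t i' -> letter_path t0 i t = nth i' (letters t) e.
Proof.
  intros H. unfold letter_path.
  destruct excluded_middle_informative as [Ha|Ha]; [|exfalso; apply Ha; now exists i'].
  destruct constructive_indefinite_description as [j Hj]; simpl. f_equal.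
  apply (same_letter_fun t). eapply same_letter_trans; [|exact H].
  now apply same_letter_sym.
Qed.

Lemma letter_path_dead t0 i t : ~ alive t0 i t -> letter_path t0 i t = e.
Proof.
  intros H. unfold letter_path. destruct excluded_middle_informative; tauto.
Qed.

Lemma alive_of_ne t0 i t : letter_path t0 i t <> e -> alive t0 i t.
Proof. intros H. apply NNPP. intros HN. apply H. now apply letter_path_dead. Qed.

Lemma alive_convex t0 i t t' s : alive t0 i t -> alive t0 i t' -> between t t' s -> alive t0 i s.
Proof.
  intros [j Hj] [j' Hj'] Hs.
  destruct (same_letter_convex t j t' j' s Hs) as [k Hk].
  - eapply same_letter_trans; [apply same_letter_sym; exact Hj|exact Hj'].
  - exists k. eapply same_letter_trans; [exact Hj|exact Hk].
Qed.

Lemma nbhds_single l k W : (k < length l)%nat -> O W -> W (nth k l e) ->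
  exists Ws, nbhds O Ws l /\ nth k Ws (fun _ => False) = W.
Proof.
  revert k. induction l as [|a l IH]; intros k Hk HO' HW; simpl in *; [lia|].
  destruct k.
  - destruct (nbhds_true O HO l) as [Ws HWs]. exists (W :: Ws). split; auto. constructor; auto.
  - destruct (IH k) as [Ws [H1 H2]]; auto; [lia|]. exists ((fun _ => True) :: Ws).
    split; auto. constructor; auto. split; auto. apply (open_true O HO).
Qed.

(** Births and deaths are continuous: a letter near [t1] that does not continue one present at [t1]
    lies in any prescribed neighbourhood of [e]. *)
Lemma letter_path_continuous t0 i t1 W : O W -> W (letter_path t0 i t1) ->
  near t1 (fun t => W (letter_path t0 i t)).
Proof.
  intros HW HWt. destruct (classic (alive t0 i t1)) as [[i1 Hi1]|Hd].
  - rewrite (letter_path_eq _ _ _ _ Hi1) in HWt.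
    pose proof (same_letter_valid _ _ _ _ Hi1) as Hlt.
    destruct (nbhds_single (letters t1) i1 W) as [Ws [H1 H2]]; auto.
    eapply near_mono; [|apply (near_moving_letters t1 (fun _ => True) Ws); auto; apply (open_true O HO)].
    cbv beta. intros t [Ha _]. destruct (Ha i1 Hlt) as [i' [H3 H4]].
    rewrite (letter_path_eq t0 i t i'); [|eapply same_letter_trans; eauto].
    now rewrite H2 in H4.
  - rewrite (letter_path_dead _ _ _ Hd) in HWt.
    destruct (nbhds_true O HO (letters t1)) as [Ws HWs].
    eapply near_mono; [|apply (near_moving_letters t1 W Ws); auto].
    cbv beta. intros t [_ Hb]. destruct (classic (alive t0 i t)) as [[i' Hi']|Hd'].
    + rewrite (letter_path_eq _ _ _ _ Hi').
      destruct (Hb i') as [H|[j Hj]]; auto; [eapply same_letter_valid; eauto|].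
      exfalso. apply Hd. exists j.
      eapply same_letter_trans; [exact Hi'|now apply same_letter_sym].
    + rewrite (letter_path_dead _ _ _ Hd'). auto.
Qed.

(** * Names for the countably many moving letters *)

Context (Hout : forall t, t <= 0 \/ 1 <= t -> letters t = nil).

Lemma alive_inside t0 i t : alive t0 i t -> 0 < t < 1.
Proof.
  intros [i' H]. apply same_letter_valid in H.
  destruct (Rle_lt_dec t 0); [rewrite Hout in H by auto; simpl in H; lia|].
  destruct (Rle_lt_dec 1 t); [rewrite Hout in H by auto; simpl in H; lia|]. lra.
Qed.

(* A moving letter is named by a rational time together with its position in the word at that time. *)
Definition code_time (c : nat) : R :=
  let p := Cantor.of_nat (fst (Cantor.of_nat c)) in INR (fst p) / INR (S (snd p)).

Definition code_index (c : nat) : nat := snd (Cantor.of_nat c).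

(** The least code of its [same_letter] class, so that every moving letter has exactly one name. *)
Definition canonical (c : nat) : Prop :=
  (code_index c < length (letters (code_time c)))%nat /\
  forall c', (c' < c)%nat ->
    ~ same_letter (code_time c') (code_index c') (code_time c) (code_index c).

Lemma rational_after t eps : 0 < t -> 0 < eps ->
  exists b r, t < INR b / INR (S r) < t + eps.
Proof.
  intros Ht Heps. destruct (archimed_cor1 eps Heps) as [r [Hr Hr0]].
  apply lt_0_INR in Hr0.
  assert (Hz : 0 <= t * INR (S r)) by (apply Rmult_le_pos; [lra|apply pos_INR]).
  destruct (archimed (t * INR (S r))) as [H1 H2].
  exists (Z.to_nat (up (t * INR (S r)))), r.
  assert (HS : 0 < INR (S r)) by (apply lt_0_INR; lia).
  rewrite INR_IZR_INZ, Z2Nat.id by (apply le_IZR; lra).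
  split.
  - apply Rmult_lt_reg_r with (INR (S r)); auto.
    unfold Rdiv. rewrite Rmult_assoc, Rinv_l by lra. lra.
  - apply Rmult_lt_reg_r with (INR (S r)); auto.
    unfold Rdiv. rewrite Rmult_assoc, Rinv_l by lra.
    assert (1 < eps * INR (S r)); [|lra].
    rewrite S_INR. apply Rmult_lt_compat_r with (r := INR r) in Hr; auto.
    rewrite Rinv_l in Hr; lra.
Qed.

(** A letter present at [t] is present at all times close to [t], in particular at a rational
    one. *)
Lemma canonical_exists t i : (i < length (letters t))%nat ->
  exists c, canonical c /\ same_letter (code_time c) (code_index c) t i.
Proof.
  intros Hi.
  assert (Ht : 0 < t).
  { destruct (Rle_lt_dec t 0); auto. rewrite Hout in Hi by auto. simpl in Hi. lia. }
  assert (Hex : exists c, same_letter (code_time c) (code_index c) t i).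
  { destruct (nbhds_true O HO (letters t)) as [Ws HWs].
    destruct (near_moving_letters t (fun _ => True) Ws (open_true O HO) Logic.I HWs)
      as [eps [Heps H]].
    destruct (rational_after t eps Ht Heps) as [b [r Hbr]].
    destruct (H (INR b / INR (S r))) as [Ha _]; [apply Rabs_def1; lra|].
    destruct (Ha i Hi) as [i' [Hi' _]].
    exists (Cantor.to_nat (Cantor.to_nat (b, r), i')).
    unfold code_time, code_index. rewrite Cantor.cancel_of_to. cbn [fst snd].
    rewrite Cantor.cancel_of_to. cbn [fst snd]. now apply same_letter_sym. }
  destruct Hex as [c Hc]. induction c as [c IH] using (well_founded_induction lt_wf).
  destruct (classic (exists c', (c' < c)%nat /\ same_letter (code_time c') (code_index c') t i))
    as [[c' [Hlt Hc']]|HN].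
  - apply (IH c' Hlt Hc').
  - exists c. split; auto. split.
    + eapply same_letter_valid. apply same_letter_sym. exact Hc.
    + intros c' Hlt Hs. apply HN. exists c'. split; auto.
      eapply same_letter_trans; eauto.
Qed.

Lemma canonical_unique c c' t i : canonical c -> canonical c' ->
  same_letter (code_time c) (code_index c) t i ->
  same_letter (code_time c') (code_index c') t i -> c = c'.
Proof.
  intros [_ Hc] [_ Hc'] H H'.
  destruct (Nat.lt_trichotomy c c') as [Hl|[Hl|Hl]]; auto; exfalso.
  - apply (Hc' c Hl). eapply same_letter_trans; [exact H|now apply same_letter_sym].
  - apply (Hc c' Hl). eapply same_letter_trans; [exact H'|now apply same_letter_sym].
Qed.

(** Total thanks to [epsilon]; meaningful only for positions [i] in the word at [t]. *)
Definition code_of (t : R) (i : nat) : nat :=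
  epsilon (inhabits 0%nat)
    (fun c => canonical c /\ same_letter (code_time c) (code_index c) t i).

Lemma code_of_spec t i : (i < length (letters t))%nat ->
  canonical (code_of t i) /\
  same_letter (code_time (code_of t i)) (code_index (code_of t i)) t i.
Proof. intros Hi. unfold code_of. apply epsilon_spec. now apply canonical_exists. Qed.

Lemma code_of_eq c t i : canonical c -> same_letter (code_time c) (code_index c) t i ->
  code_of t i = c.
Proof.
  intros Hc H. destruct (code_of_spec t i) as [H1 H2]; [eapply same_letter_valid; eauto|].
  eapply canonical_unique; eauto.
Qed.

Definition coded_path (c : nat) : R -> X := letter_path (code_time c) (code_index c).
Definition coded_alive (c : nat) : R -> Prop := alive (code_time c) (code_index c).

(** Near [t1], every letter outside [V] continues one of the finitely many letters of [g t1];
    compactness of the interval does the rest. *)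
Lemma finitely_many_large V : O V -> V e ->
  exists L : list nat, forall c t, canonical c -> ~ V (coded_path c t) -> In c L.
Proof.
  intros HV HVe.
  assert (H01 : exists L : list nat, forall c t, 0 <= t <= 1 ->
     canonical c -> ~ V (coded_path c t) -> In c L).
  { apply (interval_induction (fun a b => exists L : list nat, forall c t, a <= t <= b ->
     canonical c -> ~ V (coded_path c t) -> In c L)); [| |lra].
    - intros t1. destruct (nbhds_true O HO (letters t1)) as [Ws HWs].
      destruct (near_moving_letters t1 V Ws HV HVe HWs) as [eps [Heps H]].
      exists eps. split; auto. intros a b Ha Hat Htb Hb.
      exists (map (code_of t1) (seq 0 (length (letters t1)))).
      intros c t Ht Hc HVc.
      destruct (H t) as [_ Hcov]; [apply Rabs_def1; lra|].
      destruct (alive_of_ne (code_time c) (code_index c) t) as [i' Hi'].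
      { intros He. apply HVc. unfold coded_path. now rewrite He. }
      destruct (Hcov i') as [Hv|[i Hi]]; [eapply same_letter_valid; eauto| |].
      + exfalso. apply HVc. unfold coded_path. now rewrite (letter_path_eq _ _ _ _ Hi').
      + apply in_map_iff. exists i. split.
        * apply code_of_eq; auto. eapply same_letter_trans; [exact Hi'|now apply same_letter_sym].
        * apply in_seq. split; [lia|]. eapply same_letter_valid. apply same_letter_sym. exact Hi.
    - intros a b c' Hab Hbc [L1 H1] [L2 H2]. exists (L1 ++ L2). intros c t Ht Hc HVc.
      apply in_or_app. destruct (Rle_lt_dec t b); [left; apply (H1 c t)|right; apply (H2 c t)]; auto; lra. }
  destruct H01 as [L HL]. exists L. intros c t Hc HVc. apply (HL c t); auto.
  assert (Ha : coded_alive c t).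
  { apply alive_of_ne. intros He. apply HVc. unfold coded_path. now rewrite He. }
  apply alive_inside in Ha. lra.
Qed.

(** * Delaying the letters separately *)

Context (tau : R -> R -> R) (theta : nat -> R -> R -> R).
Context (Htau : forall u s, continuous2_at tau u s)
        (Htheta : forall c u s, continuous2_at (theta c) u s).
Context (Halive : forall c u s, canonical c ->
           coded_alive c (theta c u s) -> coded_alive c (tau u s)).

(** The clock [tau] decides which letters are listed and in which order; [theta c] decides where
    letter [c] stands. A letter outside its life shows as [e], which [to_word] strips. *)
Definition moved (u s : R) : list X :=
  map (fun i => coded_path (code_of (tau u s) i) (theta (code_of (tau u s) i) u s))
      (seq 0 (length (letters (tau u s)))).

Lemma moved_length u s : length (moved u s) = length (letters (tau u s)).
Proof. unfold moved. now rewrite length_map, length_seq. Qed.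

Lemma moved_nth u s i : (i < length (letters (tau u s)))%nat ->
  nth i (moved u s) e = coded_path (code_of (tau u s) i) (theta (code_of (tau u s) i) u s).
Proof.
  intros Hi. unfold moved.
  set (f := fun i => coded_path (code_of (tau u s) i) (theta (code_of (tau u s) i) u s)).
  rewrite (nth_indep _ _ (f 0%nat)) by now rewrite length_map, length_seq.
  rewrite map_nth, seq_nth; auto.
Qed.

(* Delaying the letters separately is continuous: near a point only finitely many of them leave a given
   neighbourhood of [e], and no new pair of letters meets. *)
Lemma moved_continuous W u0 s0 : J_open X O e W -> W (to_word e (moved u0 s0)) ->
  near2 u0 s0 (fun u s => W (to_word e (moved u s))).
Proof.
  intros HW HW0. set (t0 := tau u0 s0).
  destruct (locally_bounded_length O e HO HT2 g t0) as [eps [N [Heps HN]]].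
  { intros W' HW' HW'0. exact (Hg t0 W' HW' HW'0). }
  destruct (J_open_interleaved_nbhd O e HO W (moved u0 s0) N HW HW0)
    as [V [Us [HV [HVe [HUs HWn]]]]].
  destruct (finitely_many_large V HV HVe) as [L HL].
  pose proof (Forall2_length HUs) as HlenU. rewrite moved_length in HlenU. fold t0 in HlenU.
  destruct (nbhds_true O HO (letters t0)) as [Ws HWs].
  assert (HnU : forall j, (j < length (letters t0))%nat ->
     O (nth j Us (fun _ => False)) /\
     nth j Us (fun _ => False) (coded_path (code_of t0 j) (theta (code_of t0 j) u0 s0))).
  { intros j Hj. pose proof (moved_nth u0 s0 j Hj) as Hn. fold t0 in Hn. rewrite <- Hn.
    assert (Hj' : (j < length (moved u0 s0))%nat) by (rewrite moved_length; exact Hj).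
    clear - HUs Hj'. revert j Hj'. unfold nbhds in HUs.
    induction HUs as [|U a Us l H HUs IH]; simpl; intros j Hj; [lia|].
    destruct j; auto. apply IH. lia. }
  pose proof (near2_comp tau u0 s0 _ (Htau u0 s0)
    (near_and _ _ _ (ex_intro _ eps (conj Heps HN)) (near_moving_letters t0 V Ws HV HVe HWs)))
    as Hword.
  assert (Hbig : near2 u0 s0 (fun u s => forall j, In j (seq 0 (length (letters t0))) ->
     nth j Us (fun _ => False) (coded_path (code_of t0 j) (theta (code_of t0 j) u s)))).
  { apply near2_all. intros j Hj. apply in_seq in Hj.
    apply (near2_comp (theta (code_of t0 j)) u0 s0
       (fun t => nth j Us (fun _ => False) (coded_path (code_of t0 j) t))); auto.
    apply letter_path_continuous; apply HnU; lia. }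
  (* By [Halive], a letter absent at clock time [t0] is at [e] when [(u, s) = (u0, s0)], hence in
     [V] nearby. Letters outside [L] never leave [V]. *)
  assert (Hsmall : near2 u0 s0 (fun u s => forall c, In c L ->
     canonical c -> ~ coded_alive c t0 -> V (coded_path c (theta c u s)))).
  { apply near2_all. intros c _.
    destruct (classic (canonical c /\ ~ coded_alive c t0)) as [[Hc Hd]|HN'].
    - eapply near2_mono; [|apply (near2_comp (theta c) u0 s0 (fun t => V (coded_path c t)));
        [auto|apply letter_path_continuous; auto]].
      + cbv beta. auto.
      + replace (letter_path _ _ _) with e; auto. symmetry. apply letter_path_dead.
        intros Ha. apply Hd. unfold t0. apply (Halive c u0 s0); auto.
    - exists 1. split; [lra|]. intros u s _ _ Hc Hd. exfalso. auto. }
  eapply near2_mono; [|exact (near2_and _ _ _ _ Hword (near2_and _ _ _ _ Hbig Hsmall))].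
  clear Hword Hbig Hsmall. cbv beta. intros u s [[Hlen [Hmv _]] [Hbig Hsmall]].
  apply HWn; [rewrite moved_length; auto|].
  apply (interleaved_of_positions _ _ e _ (fun j i => same_letter t0 j (tau u s) i)).
  - intros j Hj. rewrite HlenU in Hj. destruct (Hmv j Hj) as [i [Hi _]].
    pose proof (same_letter_valid _ _ _ _ Hi) as Hv.
    exists i. rewrite moved_length. repeat split; auto.
    rewrite moved_nth by auto. destruct (code_of_spec t0 j Hj) as [Hc Hs].
    rewrite (code_of_eq (code_of t0 j) (tau u s) i); auto.
    + apply Hbig. apply in_seq. lia.
    + eapply same_letter_trans; eauto.
  - intros i Hi. rewrite moved_length in Hi. rewrite moved_nth by auto.
    destruct (code_of_spec _ _ Hi) as [Hc Hs].
    destruct (classic (coded_alive (code_of (tau u s) i) t0)) as [[j Hj]|Hd].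
    + right. exists j. rewrite HlenU. split; [eapply same_letter_valid; eauto|].
      eapply same_letter_trans; [apply same_letter_sym; exact Hj|exact Hs].
    + left. apply NNPP. intros HVn. pose proof (HL _ _ Hc HVn) as Hin.
      apply HVn. apply Hsmall; auto.
  - intros j i j' i'. apply same_letter_lt.
Qed.

End Tracking.

(** * A clock with disjoint rests *)

Fixpoint partial_mass (A : nat -> Prop) (N : nat) : R :=
  match N with
  | O => 0
  | S n => partial_mass A n + (if excluded_middle_informative (A n) then (/ 2) ^ (S n) else 0)
  end.

Lemma half_pow_pos n : 0 < (/ 2) ^ n.
Proof. apply pow_lt. lra. Qed.

Lemma partial_mass_bound A N : 0 <= partial_mass A N <= 1 - (/ 2) ^ N.
Proof.
  induction N as [|N IH]; simpl; [lra|].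
  pose proof (half_pow_pos N). destruct excluded_middle_informative; lra.
Qed.

Lemma partial_mass_add (A B : nat -> Prop) d N : (forall n, A n -> B n) -> ~ A d -> B d ->
  partial_mass A N + (if le_lt_dec N d then 0 else (/ 2) ^ (S d)) <= partial_mass B N.
Proof.
  intros HAB Hd Hd'. induction N as [|N IH]; [simpl; lra|].
  cbn [partial_mass]. pose proof (half_pow_pos (S N)).
  destruct (le_lt_dec N d), (le_lt_dec (S N) d),
    (excluded_middle_informative (A N)) as [Hs|Hs], (excluded_middle_informative (B N)) as [Hs'|Hs'];
    try lia; try lra; try (exfalso; auto; fail);
    try (assert (N = d) as -> by lia; try contradiction; lra).
Qed.

Lemma partial_mass_le (A B : nat -> Prop) N M : (forall n, A n -> B n) -> (N <= M)%nat ->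
  partial_mass A N <= partial_mass B M.
Proof.
  intros HAB HNM. induction HNM as [|M HNM IH].
  - induction N as [|N IH]; simpl; [lra|]. pose proof (half_pow_pos N).
    destruct (excluded_middle_informative (A N)), (excluded_middle_informative (B N));
      try lra. exfalso; auto.
  - simpl. pose proof (half_pow_pos M). destruct excluded_middle_informative; lra.
Qed.

Definition mass_spec (A : nat -> Prop) : { m : R | is_lub (fun x => exists N, x = partial_mass A N) m }.
Proof.
  apply completeness.
  - exists 1. intros x [N ->]. pose proof (partial_mass_bound A N). pose proof (half_pow_pos N). lra.
  - exists 0, 0%nat. reflexivity.
Qed.

Definition mass (A : nat -> Prop) : R := proj1_sig (mass_spec A).

Lemma mass_bound A : 0 <= mass A <= 1.
Proof.
  unfold mass. destruct (mass_spec A) as [m [H1 H2]]; simpl. split.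
  - apply H1. exists 0%nat. reflexivity.
  - apply H2. intros x [N ->]. pose proof (partial_mass_bound A N). pose proof (half_pow_pos N). lra.
Qed.

(** Provides the room for the rest of [d] ahead of all later rests. *)
Lemma mass_add (A B : nat -> Prop) d : (forall n, A n -> B n) -> ~ A d -> B d ->
  mass A + (/ 2) ^ (S d) <= mass B.
Proof.
  intros HAB Hd Hd'. unfold mass.
  destruct (mass_spec A) as [m [H1 H2]], (mass_spec B) as [m' [H1' H2']]; simpl proj1_sig.
  assert (m <= m' - (/ 2) ^ (S d)); [|lra].
  apply H2. intros x [N ->].
  pose proof (partial_mass_add A B d (N + S d) HAB Hd Hd') as H.
  destruct (le_lt_dec (N + S d) d); [lia|].
  pose proof (partial_mass_le A A N (N + S d) ltac:(auto) ltac:(lia)) as Hle.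
  assert (partial_mass B (N + S d) <= m') by (apply H1'; eauto). lra.
Qed.

(* [k c] is [T c] plus the total length of the rests preceding [c], the rest [d] having length
   2^-(d+1), so that the times [T c] may coincide or be dense; [phi] is a supremum of McShane type. *)
Lemma time_stretching (T : nat -> R) : (forall c, 0 <= T c <= 1) ->
  exists (phi : R -> R) (k k' : nat -> R),
    (forall x y, x <= y -> phi x <= phi y <= phi x + (y - x)) /\
    phi 0 = 0 /\ phi 2 = 1 /\
    (forall c, 0 <= k c /\ k c < k' c /\ k' c <= 2) /\
    (forall c v, k c <= v <= k' c -> phi v = T c) /\
    (forall c d, c <> d -> k' c <= k d \/ k' d <= k c).
Proof.
  intros HT.
  (* Equal times are ordered by index, so that any two rests are comparable. *)
  set (before := fun c d => T d < T c \/ (T d = T c /\ (d < c)%nat)).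
  set (k := fun c => T c + mass (before c)).
  set (k' := fun c => k c + (/ 2) ^ (S c)).
  (* More than disjointness: the extra gap [T c - T d] lets the clock climb between the rests with
     slope at most one. *)
  assert (Hstep : forall c d, before c d -> k' d + (T c - T d) <= k c).
  { intros c d Hcd. unfold k', k.
    assert (mass (before d) + (/ 2) ^ (S d) <= mass (before c)); [|lra].
    apply mass_add; auto.
    - intros n. unfold before in *. intros Hn.
      destruct (Rlt_le_dec (T n) (T c)) as [Hl|Hl]; [now left|].
      right. split; [lra|]. destruct Hcd, Hn; try lra. lia.
    - unfold before. intros [H|[_ H]]; [lra|lia]. }
  assert (Htri : forall c d, c <> d -> before c d \/ before d c).
  { intros c d Hcd. unfold before.
    destruct (Rtotal_order (T c) (T d)) as [H|[H|H]]; auto.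
    destruct (Nat.lt_trichotomy c d) as [H'|[H'|H']]; auto; contradiction. }
  assert (Hk : forall c, T c <= k c /\ k c < k' c /\ k' c <= T c + 1).
  { intros c. unfold k', k. pose proof (mass_bound (before c)). pose proof (half_pow_pos (S c)).
    assert (mass (before c) + (/ 2) ^ (S c) <= mass (fun _ => True)).
    { apply mass_add; auto. unfold before. intros [H'|[_ H']]; [lra|lia]. }
    pose proof (mass_bound (fun _ => True)). lra. }
  (* Every member is nondecreasing in [v] with slope at most one, and so is the supremum. The first
     one fixes the values at 0 and 2; it does not disturb the rest of [c], since
     [k' c <= T c + 1]. *)
  set (E := fun v y => y = Rmax 0 (v - 1) \/ exists c, y = T c - Rmax 0 (k c - v)).
  assert (HE : forall v, { m | is_lub (E v) m }).
  { intros v. apply completeness.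
    - exists (Rmax 1 (v - 1)). intros y [->|[c ->]].
      + unfold Rmax. repeat destruct Rle_dec; lra.
      + specialize (HT c). unfold Rmax. repeat destruct Rle_dec; lra.
    - exists (Rmax 0 (v - 1)). now left. }
  set (phi := fun v => proj1_sig (HE v)).
  assert (Hphi : forall v, is_lub (E v) (phi v)).
  { intros v. unfold phi. now destruct (HE v). }
  clearbody phi. clear HE.
  assert (Heq : forall v y, E v y -> (forall z, E v z -> z <= y) -> phi v = y).
  { intros v y Hy Hz. destruct (Hphi v) as [H1 H2]. apply Rle_antisym; auto. }
  exists phi, k, k'. split; [|split; [|split; [|split; [|split]]]].
  - intros x y Hxy. destruct (Hphi x) as [H1 H2], (Hphi y) as [H1' H2']. split.
    + apply H2. intros z [->|[c ->]].
      * eapply Rle_trans; [|apply H1'; now left]. unfold Rmax. repeat destruct Rle_dec; lra.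
      * eapply Rle_trans; [|apply H1'; right; exists c; reflexivity].
        unfold Rmax. repeat destruct Rle_dec; lra.
    + apply H2'. intros z [->|[c ->]].
      * assert (Rmax 0 (x - 1) <= phi x) by (apply H1; now left).
        revert H. unfold Rmax. repeat destruct Rle_dec; lra.
      * assert (T c - Rmax 0 (k c - x) <= phi x) by (apply H1; right; now exists c).
        revert H. unfold Rmax. repeat destruct Rle_dec; lra.
  - apply Heq; [left; unfold Rmax; destruct Rle_dec; lra|].
    intros z [->|[c ->]]; [unfold Rmax; destruct Rle_dec; lra|].
    specialize (Hk c). specialize (HT c). unfold Rmax. destruct Rle_dec; lra.
  - apply Heq; [left; unfold Rmax; destruct Rle_dec; lra|].
    intros z [->|[c ->]]; [unfold Rmax; destruct Rle_dec; lra|].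
    specialize (HT c). unfold Rmax. destruct Rle_dec; lra.
  - intros c. specialize (Hk c). specialize (HT c). lra.
  - intros c v Hv. apply Heq.
    + right. exists c. unfold Rmax. destruct Rle_dec; lra.
    + intros z [->|[d ->]].
      * pose proof (Hk c). specialize (HT c). unfold Rmax. destruct Rle_dec; lra.
      * destruct (Nat.eq_dec c d) as [<-|Hcd]; [unfold Rmax; destruct Rle_dec; lra|].
        destruct (Htri c d Hcd) as [Hb|Hb].
        -- assert (T d <= T c) by (unfold before in Hb; lra).
           unfold Rmax. destruct Rle_dec; lra.
        -- pose proof (Hstep d c Hb). unfold Rmax. destruct Rle_dec; lra.
  - intros c d Hcd. destruct (Htri c d Hcd) as [Hb|Hb]; pose proof (Hstep _ _ Hb);
      unfold before in Hb; [right|left]; lra.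
Qed.

(** * Continuity in two real variables *)

Definition clamp (x : R) : R := Rmax 0 (Rmin 1 x).

Lemma clamp_bound x : 0 <= clamp x <= 1.
Proof. unfold clamp, Rmax, Rmin. repeat destruct Rle_dec; lra. Qed.

Lemma clamp_id x : 0 <= x <= 1 -> clamp x = x.
Proof. unfold clamp, Rmax, Rmin. repeat destruct Rle_dec; lra. Qed.

Lemma clamp_low x : x <= 0 -> clamp x = 0.
Proof. unfold clamp, Rmax, Rmin. repeat destruct Rle_dec; lra. Qed.

Lemma clamp_high x : 1 <= x -> clamp x = 1.
Proof. unfold clamp, Rmax, Rmin. repeat destruct Rle_dec; lra. Qed.

Lemma clamp_lipschitz x y : x <= y -> clamp x <= clamp y <= clamp x + (y - x).
Proof. intros H. unfold clamp, Rmax, Rmin. repeat destruct Rle_dec; lra. Qed.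

Lemma continuous2_const a u s : continuous2_at (fun _ _ => a) u s.
Proof.
  intros eps Heps. exists 1. split; [lra|]. intros. rewrite Rminus_diag, Rabs_R0. auto.
Qed.

Lemma continuous2_fst u s : continuous2_at (fun x _ => x) u s.
Proof. intros eps Heps. exists eps. auto. Qed.

Lemma continuous2_snd u s : continuous2_at (fun _ y => y) u s.
Proof. intros eps Heps. exists eps. auto. Qed.

Lemma continuous2_plus f h u s : continuous2_at f u s -> continuous2_at h u s ->
  continuous2_at (fun x y => f x y + h x y) u s.
Proof.
  intros Hf Hh eps Heps.
  eapply near2_mono; [|exact (near2_and _ _ _ _ (Hf (eps / 2) ltac:(lra)) (Hh (eps / 2) ltac:(lra)))].
  cbv beta. intros x y [H1 H2].
  replace (f x y + h x y - (f u s + h u s)) with ((f x y - f u s) + (h x y - h u s)) by ring.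
  pose proof (Rabs_triang (f x y - f u s) (h x y - h u s)). lra.
Qed.

Lemma continuous2_mult f h u s : continuous2_at f u s -> continuous2_at h u s ->
  continuous2_at (fun x y => f x y * h x y) u s.
Proof.
  intros Hf Hh eps Heps.
  set (A := Rabs (f u s)). set (B := Rabs (h u s)).
  assert (HA : 0 <= A) by apply Rabs_pos. assert (HB : 0 <= B) by apply Rabs_pos.
  set (d := Rmin 1 (eps / (A + B + 1))).
  assert (Hd0 : 0 < eps / (A + B + 1)) by (apply Rdiv_lt_0_compat; lra).
  assert (Hd : 0 < d) by (apply Rmin_glb_lt; lra).
  eapply near2_mono; [|exact (near2_and _ _ _ _ (Hf d Hd) (Hh d Hd))].
  cbv beta. intros x y [H1 H2].
  replace (f x y * h x y - f u s * h u s) with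
    ((f x y - f u s) * (h x y - h u s) + ((f x y - f u s) * h u s + f u s * (h x y - h u s))) by ring.
  eapply Rle_lt_trans; [apply Rabs_triang|].
  eapply Rle_lt_trans; [apply Rplus_le_compat_l; apply Rabs_triang|].
  rewrite !Rabs_mult. fold A B.
  assert (Hd1 : d <= 1) by apply Rmin_l.
  assert (Hd2 : d * (A + B + 1) <= eps).
  { apply Rle_trans with (eps / (A + B + 1) * (A + B + 1)).
    - apply Rmult_le_compat_r; [lra|apply Rmin_r].
    - right. field. lra. }
  pose proof (Rabs_pos (f x y - f u s)). pose proof (Rabs_pos (h x y - h u s)). nra.
Qed.

Lemma continuous2_lipschitz p f u s :
  (forall x y, x <= y -> p x <= p y <= p x + (y - x)) ->
  continuous2_at f u s -> continuous2_at (fun x y => p (f x y)) u s.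
Proof.
  intros Hp Hf eps Heps. eapply near2_mono; [|exact (Hf eps Heps)].
  cbv beta. intros x y H. eapply Rle_lt_trans; [|exact H].
  destruct (Rle_lt_dec (f x y) (f u s)) as [Hl|Hl].
  - pose proof (Hp _ _ Hl). unfold Rabs. repeat destruct Rcase_abs; lra.
  - pose proof (Hp _ _ (Rlt_le _ _ Hl)). unfold Rabs. repeat destruct Rcase_abs; lra.
Qed.

(** * The deformation to a loop of single letters *)

Section Unshuffling.
Context {X : Type} (O : (X -> Prop) -> Prop) (e : X).
Context (HO : is_topology O) (HT2 : hausdorff O).
Context (g : R -> word X e).
Context (Hg : forall t0 W, J_open X O e W -> W (g t0) -> near t0 (fun t => W (g t))).
Context (Hout : forall t, t <= 0 \/ 1 <= t -> letters e g t = nil).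
Context (phi : R -> R) (k k' : nat -> R).
Context (Hphi : forall x y, x <= y -> phi x <= phi y <= phi x + (y - x)).
Context (Hphi0 : phi 0 = 0) (Hphi2 : phi 2 = 1).
Context (Hk : forall c, 0 <= k c /\ k c < k' c /\ k' c <= 2).
Context (Hrest : forall c v, k c <= v <= k' c -> phi v = clamp (code_time c)).
Context (Hdisj : forall c d, c <> d -> k' c <= k d \/ k' d <= k c).

Notation path := (coded_path O e HO HT2 g).
Notation living := (coded_alive O e HO HT2 g).
Notation canon := (canonical O e HO HT2 g).

(** The factor 2 is there because the stretched clock runs over [0,2]; all of [0,1] is traversed
    linearly during the rest of [c]. *)
Definition progress (c : nat) (u : R) : R := clamp ((2 * clamp u - k c) * / (k' c - k c)).

(* First half of the deformation: time is stretched. Second half: each letter [c] is delayed until it runs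
   within [k c, k' c]. *)
Definition time_at (u s : R) : R :=
  (1 + -1 * clamp (2 * s)) * clamp u + clamp (2 * s) * phi (2 * clamp u).
Definition letter_time (c : nat) (u s : R) : R :=
  (1 + -1 * clamp (2 * s + -1)) * time_at u s + clamp (2 * s + -1) * progress c u.

Lemma continuous2_scale a f u s : continuous2_at f u s -> continuous2_at (fun x y => a * f x y) u s.
Proof. intros H. apply continuous2_mult; auto. apply continuous2_const. Qed.

Lemma continuous2_clamp f u s : continuous2_at f u s -> continuous2_at (fun x y => clamp (f x y)) u s.
Proof. apply continuous2_lipschitz. exact clamp_lipschitz. Qed.

Lemma time_at_continuous u s : continuous2_at time_at u s.
Proof.
  unfold time_at.
  pose proof (continuous2_clamp _ u s (continuous2_scale 2 _ u s (continuous2_snd u s))) as H2s.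
  pose proof (continuous2_clamp _ u s (continuous2_fst u s)) as Hu.
  apply continuous2_plus; apply continuous2_mult; auto.
  - apply continuous2_plus; [apply continuous2_const|apply (continuous2_scale (-1)); auto].
  - apply (continuous2_lipschitz phi); auto. apply continuous2_scale; auto.
Qed.

Lemma progress_continuous c u s : continuous2_at (fun u _ => progress c u) u s.
Proof.
  unfold progress. apply continuous2_clamp. apply continuous2_mult; [|apply continuous2_const].
  apply (continuous2_plus (fun u _ => 2 * clamp u) (fun _ _ => - k c)); [|apply continuous2_const].
  apply continuous2_scale. apply continuous2_clamp. apply continuous2_fst.
Qed.

Lemma letter_time_continuous c u s : continuous2_at (letter_time c) u s.
Proof.
  unfold letter_time.
  assert (H2s : continuous2_at (fun _ s => clamp (2 * s + -1)) u s).
  { apply continuous2_clamp. apply continuous2_plus; [|apply continuous2_const].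
    apply continuous2_scale. apply continuous2_snd. }
  apply continuous2_plus; apply continuous2_mult; auto.
  - apply continuous2_plus; [apply continuous2_const|apply (continuous2_scale (-1)); auto].
  - apply time_at_continuous.
  - apply progress_continuous.
Qed.

Lemma code_time_alive c : canon c -> living c (code_time c).
Proof. intros [H _]. exists (code_index c). now apply same_letter_refl. Qed.

Lemma canonical_rest c v : canon c -> k c <= v <= k' c -> phi v = code_time c.
Proof.
  intros Hc Hv. rewrite (Hrest c v Hv). apply clamp_id.
  pose proof (alive_inside O e HO HT2 g Hout _ _ _ (code_time_alive c Hc)). lra.
Qed.

Lemma phi_range v : 0 <= v <= 2 -> 0 <= phi v <= 1.
Proof.
  intros Hv. pose proof (Hphi 0 v ltac:(lra)). pose proof (Hphi v 2 ltac:(lra)). lra.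
Qed.

Lemma progress_low c u : 2 * clamp u <= k c -> progress c u = 0.
Proof.
  intros H. apply clamp_low. destruct (Hk c) as [_ [H1 _]].
  assert (0 < / (k' c - k c)) by (apply Rinv_0_lt_compat; lra). nra.
Qed.

Lemma progress_high c u : k' c <= 2 * clamp u -> progress c u = 1.
Proof.
  intros H. apply clamp_high. destruct (Hk c) as [_ [H1 _]].
  apply Rmult_le_reg_r with (k' c - k c); [lra|].
  rewrite Rmult_assoc, Rinv_l by lra. lra.
Qed.

(** In the second half, before the rest of [c] its own time is at most the clock, which is at most
    [code_time c]; after the rest both inequalities are reversed. Convexity of the lifetime applies.
    During the rest the clock shows [code_time c]. *)
Lemma letter_time_alive c u s : canon c -> living c (letter_time c u s) -> living c (time_at u s).
Proof.
  intros Hc. unfold letter_time.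
  destruct (Rle_lt_dec (2 * s) 1) as [Hs|Hs].
  - rewrite (clamp_low (2 * s + -1)) by lra.
    replace ((1 + -1 * 0) * time_at u s + 0 * progress c u) with (time_at u s) by ring. auto.
  - unfold time_at. rewrite (clamp_high (2 * s)) by lra.
    replace ((1 + -1 * 1) * clamp u + 1 * phi (2 * clamp u)) with (phi (2 * clamp u)) by ring.
    set (q := clamp (2 * s + -1)). assert (Hq : 0 <= q <= 1) by apply clamp_bound.
    pose proof (clamp_bound u) as Hu. pose proof (phi_range (2 * clamp u) ltac:(lra)) as Hp.
    pose proof (code_time_alive c Hc) as Ha.
    destruct (Hk c) as [_ [Hkk _]].
    destruct (Rle_lt_dec (2 * clamp u) (k c)) as [H1|H1].
    + rewrite progress_low by auto. intros H.
      eapply alive_convex; [exact H|exact Ha|]. left.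
      pose proof (Hphi _ _ H1) as H2. rewrite (canonical_rest c (k c)) in H2 by (auto; lra).
      split; [nra|lra].
    + destruct (Rle_lt_dec (k' c) (2 * clamp u)) as [H2|H2].
      * rewrite progress_high by auto. intros H.
        eapply alive_convex; [exact H|exact Ha|]. right.
        pose proof (Hphi _ _ H2) as H3. rewrite (canonical_rest c (k' c)) in H3 by (auto; lra).
        split; [lra|nra].
      * intros _. rewrite (canonical_rest c (2 * clamp u)) by (auto; lra). exact Ha.
Qed.

Notation deformed := (moved O e HO HT2 g time_at letter_time).

Lemma deformed_continuous W u s : J_open X O e W -> W (to_word e (deformed u s)) ->
  near2 u s (fun u s => W (to_word e (deformed u s))).
Proof.
  apply moved_continuous; auto.
  - exact time_at_continuous.
  - exact letter_time_continuous.
  - exact letter_time_alive.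
Qed.

Lemma deformed_start u : 0 <= u <= 1 -> to_word e (deformed u 0) = g u.
Proof.
  intros Hu. rewrite <- (to_word_val e (g u)). f_equal.
  assert (Ht : time_at u 0 = u).
  { unfold time_at. rewrite (clamp_low (2 * 0)), (clamp_id u) by lra. ring. }
  assert (Hl : forall c, letter_time c u 0 = u).
  { intros c. unfold letter_time. rewrite Ht, (clamp_low (2 * 0 + -1)) by lra. ring. }
  change (proj1_sig (g u)) with (letters e g u).
  apply (nth_ext _ _ e e).
  - now rewrite moved_length, Ht.
  - intros i Hi. rewrite moved_length in Hi. rewrite moved_nth by auto.
    rewrite Ht in *. rewrite Hl. destruct (code_of_spec O e HO HT2 g Hg Hout u i Hi) as [_ H].
    unfold coded_path. rewrite (letter_path_eq _ _ _ _ _ _ _ _ _ H). reflexivity.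
Qed.

Lemma deformed_ends u s : u = 0 \/ u = 1 -> to_word e (deformed u s) = J_unit X e.
Proof.
  intros Hu. apply word_eq. simpl.
  assert (Hlen : length (deformed u s) = 0%nat).
  { rewrite moved_length. rewrite Hout; auto. unfold time_at. destruct Hu as [->| ->].
    - left. rewrite (clamp_id 0) by lra. replace (2 * 0) with 0 by ring. rewrite Hphi0. lra.
    - right. rewrite (clamp_id 1) by lra. replace (2 * 1) with 2 by ring. rewrite Hphi2. lra. }
  destruct (deformed u s); [reflexivity|discriminate].
Qed.

(** Open slots suffice: at the two ends [progress] is 0 or 1, where no letter is alive. *)
Definition in_slot (u : R) (c : nat) : Prop := canon c /\ k c < 2 * clamp u < k' c.

Lemma in_slot_unique u c d : in_slot u c -> in_slot u d -> c = d.
Proof.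
  intros [_ Hc] [_ Hd]. apply NNPP. intros Hn. destruct (Hdisj c d Hn); lra.
Qed.

Definition unshuffled (u : R) : X :=
  match excluded_middle_informative (exists c, in_slot u c) with
  | left H => let c := proj1_sig (constructive_indefinite_description _ H) in path c (progress c u)
  | right _ => e
  end.

Lemma unshuffled_in u c : in_slot u c -> unshuffled u = path c (progress c u).
Proof.
  intros H. unfold unshuffled.
  destruct excluded_middle_informative as [He|He]; [|exfalso; eauto].
  destruct constructive_indefinite_description as [d Hd]; simpl.
  now rewrite (in_slot_unique u d c).
Qed.

Lemma unshuffled_out u : (forall c, ~ in_slot u c) -> unshuffled u = e.
Proof.
  intros H. unfold unshuffled.
  destruct excluded_middle_informative as [[c Hc]|He]; auto. exfalso; eapply H; eauto.
Qed.

Lemma path_progress_in_slot c u : canon c -> path c (progress c u) <> e -> in_slot u c.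
Proof.
  intros Hc Hne. split; auto.
  pose proof (alive_inside O e HO HT2 g Hout _ _ _ (alive_of_ne O e HO HT2 g _ _ _ Hne)) as Hr.
  split; apply Rnot_le_lt; intros Hle.
  - rewrite progress_low in Hr by auto. lra.
  - rewrite progress_high in Hr by auto. lra.
Qed.

Lemma deformed_end u : to_word e (deformed u 1) = sigmaJ X e (unshuffled u).
Proof.
  assert (Ht : time_at u 1 = phi (2 * clamp u)).
  { unfold time_at. rewrite (clamp_high (2 * 1)) by lra. ring. }
  assert (Hl : forall c, letter_time c u 1 = progress c u).
  { intros c. unfold letter_time. rewrite (clamp_high (2 * 1 + -1)) by lra. ring. }
  assert (Hcode : forall i, (i < length (letters e g (time_at u 1)))%nat ->
    nth i (deformed u 1) e <> e -> in_slot u (code_of O e HO HT2 g (time_at u 1) i)).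
  { intros i Hi Hne. rewrite moved_nth, Hl in Hne by auto.
    apply path_progress_in_slot; auto. now apply code_of_spec. }
  assert (Hs : proj1_sig (sigmaJ X e (unshuffled u)) = strip e (unshuffled u :: nil)).
  { unfold sigmaJ. simpl. destruct excluded_middle_informative; reflexivity. }
  apply word_eq. rewrite Hs. change (strip e (deformed u 1) = strip e (unshuffled u :: nil)).
  destruct (classic (exists c, in_slot u c)) as [[c Hc]|HN].
  - pose proof Hc as [Hcan Hcu].
    (* This ensures that [c] is listed in the word at all, at position [code_index c]; the other
       letters, being outside their slots, show as [e]. *)
    assert (Htc : time_at u 1 = code_time c).
    { rewrite Ht. apply canonical_rest; auto. lra. }
    pose proof (proj1 Hcan) as Hi. rewrite <- Htc in Hi.
    assert (Hcc : code_of O e HO HT2 g (time_at u 1) (code_index c) = c).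
    { apply code_of_eq; auto. rewrite Htc in *. now apply same_letter_refl. }
    rewrite (strip_single e _ (code_index c)).
    + rewrite moved_nth, Hl, Hcc by auto. now rewrite (unshuffled_in u c).
    + now rewrite moved_length.
    + intros i Hi' Hic. rewrite moved_length in Hi'. apply NNPP. intros Hne.
      pose proof (in_slot_unique _ _ _ (Hcode i Hi' Hne) Hc) as Heq.
      destruct (code_of_spec O e HO HT2 g Hg Hout _ _ Hi') as [_ Hsame]. rewrite Heq in Hsame.
      destruct (code_of_spec O e HO HT2 g Hg Hout _ _ Hi) as [_ Hsame']. rewrite Hcc in Hsame'.
      apply Hic. apply (same_letter_fun O e HO HT2 g (time_at u 1)).
      eapply same_letter_trans; [apply same_letter_sym; exact Hsame|exact Hsame'].
  - rewrite unshuffled_out by eauto.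
    rewrite strip_const.
    + simpl. destruct excluded_middle_informative; [reflexivity|congruence].
    + intros i Hi. rewrite moved_length in Hi. apply NNPP. intros Hne. apply HN. eauto.
Qed.

Lemma near_progress c u0 W : O W -> W (path c (progress c u0)) ->
  near u0 (fun u => W (path c (progress c u))).
Proof.
  intros HW H.
  destruct (near2_comp (fun u _ => progress c u) u0 0 (fun t => W (path c t)))
    as [eps [Heps He]].
  - apply progress_continuous.
  - apply letter_path_continuous; auto.
  - exists eps. split; auto. intros u Hu. apply (He u 0); auto.
    rewrite Rminus_diag, Rabs_R0; auto.
Qed.

Lemma near_all {A : Type} u0 (L : list A) (P : A -> R -> Prop) :
  (forall c, In c L -> near u0 (P c)) -> near u0 (fun u => forall c, In c L -> P c u).
Proof.
  induction L as [|c L IH]; intros H.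
  - exists 1. split; [lra|]. intros u _ c [].
  - eapply near_mono; [|apply near_and; [apply (H c); now left|apply IH; intros d Hd; apply H; now right]].
    cbv beta. intros u [H1 H2] d [<-|Hd]; auto.
Qed.

(** Slots may accumulate at [u0], but only finitely many letters ever leave [W], and each of these
    is at [e] when [u0] lies in no slot. *)
Lemma unshuffled_continuous u0 W : O W -> W (unshuffled u0) -> near u0 (fun u => W (unshuffled u)).
Proof.
  intros HW HW0. destruct (classic (exists c, in_slot u0 c)) as [[c Hc]|HN].
  - rewrite (unshuffled_in u0 c Hc) in HW0.
    (* The distance to the ends of the slot, halved below because [2 * clamp u] moves with speed up
       to 2. *)
    set (d := Rmin (2 * clamp u0 - k c) (k' c - 2 * clamp u0)).
    destruct Hc as [Hcan Hcu].
    assert (Hd : 0 < d / 2) by (assert (0 < d) by (apply Rmin_glb_lt; lra); lra).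
    eapply near_mono; [|exact (near_and _ _ _ (near_ball u0 (d / 2) Hd) (near_progress c u0 W HW HW0))].
    cbv beta. intros u [Hu HWu]. rewrite (unshuffled_in u c); auto. split; auto.
    pose proof (Rmin_l (2 * clamp u0 - k c) (k' c - 2 * clamp u0)) as Hm1.
    pose proof (Rmin_r (2 * clamp u0 - k c) (k' c - 2 * clamp u0)) as Hm2. fold d in Hm1, Hm2.
    apply Rabs_def2 in Hu.
    destruct (Rle_lt_dec u u0) as [Hl|Hl].
    + pose proof (clamp_lipschitz _ _ Hl). lra.
    + pose proof (clamp_lipschitz _ _ (Rlt_le _ _ Hl)). lra.
  - assert (HWe : W e) by (rewrite unshuffled_out in HW0 by eauto; auto).
    destruct (finitely_many_large O e HO HT2 g Hg Hout W HW HWe) as [L HL].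
    eapply near_mono; [|apply (near_all u0 L (fun c u => canon c -> W (path c (progress c u))))].
    + cbv beta. intros u Hu. destruct (classic (exists c, in_slot u c)) as [[c Hc]|HN'].
      * rewrite (unshuffled_in u c Hc). apply NNPP. intros HnW.
        apply HnW. apply Hu; [|apply Hc]. eapply HL; [apply Hc|exact HnW].
      * rewrite unshuffled_out by eauto. auto.
    + intros c _. destruct (classic (canon c)) as [Hc|Hc].
      * eapply near_mono; [|apply (near_progress c u0 W HW)]; [cbv beta; auto|].
        replace (path c (progress c u0)) with e; auto.
        apply NNPP. intros Hne. apply HN. exists c. apply path_progress_in_slot; auto.
      * exists 1. split; [lra|]. intros; contradiction.
Qed.

Lemma unshuffled_ends u : u = 0 \/ u = 1 -> unshuffled u = e.
Proof.
  intros Hu. apply unshuffled_out. intros c [_ Hc]. specialize (Hk c).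
  destruct Hu as [-> | ->]; rewrite clamp_id in Hc by lra; lra.
Qed.

End Unshuffling.

(** * Back to the unit interval *)

Definition to_I (t : R) : I := exist _ (clamp t) (clamp_bound t).

Lemma to_I_eq t (s : I) : clamp t = proj1_sig s -> to_I t = s.
Proof.
  destruct s as [x Hx]. simpl. intros H. unfold to_I. subst x. f_equal. apply proof_irrelevance.
Qed.

Lemma to_I_val (s : I) : to_I (proj1_sig s) = s.
Proof. apply to_I_eq. apply clamp_id. apply (proj2_sig s). Qed.

Theorem mainTheorem17 (X : Type) (O : (X -> Prop) -> Prop) (e : X)
  (HO : is_topology O) (HT2 : hausdorff O) (Hpc : path_connected O) :
  forall g : I -> word X e, loop (J_open X O e) (J_unit X e) g ->
  exists a : I -> X, loop O e a /\
    homotopic_rel (J_open X O e) (J_unit X e) (fun s => sigmaJ X e (a s)) g.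
Proof.
  intros g0 [Hcont [H0 H1]].
  set (g := fun t => g0 (to_I t)).
  assert (Hg : forall t0 W, J_open X O e W -> W (g t0) -> near t0 (fun t => W (g t))).
  { intros t0 W HW HW0. destruct (Hcont W HW (to_I t0) HW0) as [eps [Heps H]].
    exists eps. split; auto. intros t Ht. apply H. simpl.
    eapply Rle_lt_trans; [|exact Ht].
    destruct (Rle_lt_dec t t0) as [Hl|Hl].
    - pose proof (clamp_lipschitz _ _ Hl). unfold Rabs. repeat destruct Rcase_abs; lra.
    - pose proof (clamp_lipschitz _ _ (Rlt_le _ _ Hl)). unfold Rabs. repeat destruct Rcase_abs; lra. }
  assert (Hout : forall t, t <= 0 \/ 1 <= t -> letters e g t = nil).
  { intros t Ht. unfold letters, g. destruct Ht as [Ht|Ht].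
    - rewrite (to_I_eq t I0), H0; [reflexivity|]. now apply clamp_low.
    - rewrite (to_I_eq t I1), H1; [reflexivity|]. now apply clamp_high. }
  (* Codes that name no letter receive a rest as well; clamping puts their times into [0,1]. *)
  destruct (time_stretching (fun c => clamp (code_time c)))
    as [phi [k [k' [Hphi [Hphi0 [Hphi2 [Hk [Hrest Hdisj]]]]]]]].
  { intros c. apply clamp_bound. }
  set (a := fun s : I => unshuffled O e HO HT2 g k k' (proj1_sig s)).
  exists a. split; [split; [|split]|].
  - intros W HW t Ht.
    destruct (unshuffled_continuous O e HO HT2 g Hg Hout k k' Hk Hdisj (proj1_sig t) W HW Ht)
      as [eps [Heps H]].
    exists eps. split; auto. intros s Hs. exact (H _ Hs).
  - unfold a. apply unshuffled_ends; auto.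
  - unfold a. apply unshuffled_ends; auto.
  (* The deformation starts at the given loop, whereas the homotopy has to end there; hence
     [1 - t]. *)
  - exists (fun q => to_word e (moved O e HO HT2 g (time_at phi) (letter_time phi k k')
              (proj1_sig (fst q)) (1 - proj1_sig (snd q)))).
    split; [|split; [|split]].
    + intros W HW q Hq.
      destruct (deformed_continuous O e HO HT2 g Hg Hout phi k k' Hphi Hphi0 Hphi2 Hk Hrest
        W _ _ HW Hq) as [eps [Heps H]].
      exists eps. split; auto. intros q' Hq1 Hq2. apply H; auto.
      destruct q as [q1 [x Hx]], q' as [q1' [y Hy]]. simpl in *.
      eapply Rle_lt_trans; [|exact Hq2]. right. rewrite <- Rabs_Ropp. f_equal. ring.
    + intros s. simpl. rewrite Rminus_0_r. apply deformed_end; auto.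
    + intros s. simpl. rewrite Rminus_diag.
      rewrite deformed_start; auto; [|apply (proj2_sig s)].
      unfold g. now rewrite to_I_val.
    + intros t. split; apply deformed_ends; auto.
Qed.
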